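(* Assume that there exist a measurable function $V:\mathsf X\to[1,\infty)$ with $\sup_{x\in C}V(x)<\infty$ and constants $\theta>0$, $b<\infty$, $\eta\in(0,1)$ such that $$\int_{\mathsf X}\sum_{k\in\mathbb N^d}\exp\{\theta(1+|k|_1)\}V(y)\,q_k(x,dy)\le\eta V(x)+b\,\mathbf 1_C(x),\qquad x\in\mathsf X,$$ where $C$ is the set in the joint minorization condition. Then there exists $\theta_1>0$ such that $$\mathbb E_{\mathfrak a}\left[\exp\{\theta_1(L_1+|Y_1|_1)\}\right]<\infty.$$ Consequently all polynomial moments of $L_1$ and $|Y_1|_1$ under $\mathbb P_{\mathfrak a}$ are finite. If a transition reward $g$ satisfies $|g(x,y,k)|\le c_g(1+|k|_1)$ for some finite constant $c_g$, then $$\mathbb E_{\mathfrak a}\left[\exp\{\theta_2R_1^*(g)\}\right]<\infty$$ for some $\theta_2>0$. In particular, $\mathbb E_{\mathfrak a}[L_1^2+|Y_1|_1^2+(R_1^*(g))^2]<\infty$, and the one-cycle reward measure $r_g$ is exponentially summable, i.e. $\sum_{u\in\mathbb N^d}e^{\theta_3|u|_1}|r_g|(u)<\infty$ for some $\theta_3>0$.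
   Context: Notation: $\mathbb N=\{0,1,2,\dots\}$, $d\ge1$; $0_d$ is the zero vector; $|k|_1=\sum_j|k_j|$. Markov renewal chain. $(\mathsf X,\mathcal X)$ is a standard Borel space and $q=(q_k)_{k\in\mathbb N^d}$ is a family of non-negative kernels on $\mathsf X$ with $\sum_{k}q_k(x,\mathsf X)=1$ for all $x$, assumed strict: $q_{0_d}=0$. The chain $(J_n,S_n)_{n\ge0}$ in $\mathsf X\times\mathbb N^d$ has $S_0=0_d$ and, with $X_{n+1}=S_{n+1}-S_n$, $\mathbb P(J_{n+1}\in A,X_{n+1}=k\mid J_0,S_0,\dots,J_n,S_n)=q_k(J_n,A)$. Put $P(x,A)=\sum_kq_k(x,A)$ and $Q(x,A\times B)=\sum_{k\in B}q_k(x,A)$. Standing assumptions. (i) $P$ is positive Harris recurrent with invariant probability $\pi$, and $0<\int_{\mathsf X}\sum_kk_rq_k(x,\mathsf X)\,\pi(dx)<\infty$ for $r=1,\dots,d$. (ii) Joint minorization: there are $C\in\mathcal X$ with $\pi(C)>0$, $\varepsilon\in(0,1]$ and a probability measure $\vartheta$ on $\mathsf X\times\mathbb N^d$ with $Q(x,\cdot)\ge\varepsilon\vartheta(\cdot)$ for $x\in C$. Split chain. $\widehat J_n=(J_n,\chi_n)$ lives in $(\mathsf X\times\{0\})\cup(C\times\{1\})$. Given $\widehat J_n=(x,1)$, $(J_{n+1},X_{n+1})$ has law $\vartheta$; given $(x,0)$ with $x\in C$ it has law $(Q(x,\cdot)-\varepsilon\vartheta)/(1-\varepsilon)$ (not used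 when $\varepsilon=1$); given $(x,0)$ with $x\notin C$ it has law $Q(x,\cdot)$. Then, given $J_{n+1}=y$, independently of the past, $\chi_{n+1}=1$ with probability $\varepsilon$ and $0$ otherwise if $y\in C$, and $\chi_{n+1}=0$ if $y\notin C$. The set $\mathfrak a=C\times\{1\}$ is an atom. $\mathbb P_{\mathfrak a}$ is the law of the split chain started from the normalized restriction to $\mathfrak a$ of its invariant probability (so $J_0\sim\pi(\cdot\cap C)/\pi(C)$, $\chi_0=1$, $S_0=0_d$). First cycle. $T_0=0$, $T_1=\inf\{n>0:\widehat J_n\in\mathfrak a\}$, $L_1=T_1$, $Y_1=S_{T_1}$. For a measurable transition reward $g:\mathsf X\times\mathsf X\times\mathbb N^d\to\mathbb R$: $R_1^*(g)=\sum_{n=0}^{T_1-1}|g(J_n,J_{n+1},X_{n+1})|$ and $$r_g(u)=\mathbb E_{\mathfrak a}\left[\sum_{n=0}^{T_1-1}g(J_n,J_{n+1},X_{n+1})\mathbf 1_{\{S_n=u\}}\right],\qquad u\in\mathbb N^d.$$ *)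

(* Defs.v *)
From HB Require Import structures.
From mathcomp Require Import all_boot all_order all_algebra.
From mathcomp Require Import all_classical all_reals all_analysis.

Set Implicit Arguments.
Unset Strict Implicit.
Unset Printing Implicit Defensive.

Import Order.TTheory GRing.Theory Num.Theory.
Import numFieldNormedType.Exports.

Local Open Scope classical_set_scope.
Local Open Scope ring_scope.
Local Open Scope ereal_scope.

Section lattice.
Variable d : nat.

(* An alias of 'rV[nat]_d, so that the discrete sigma-algebra does not become
   a canonical structure of every matrix type. *)
Definition lattice : Type := 'rV[nat]_d.

HB.instance Definition _ := GRing.Nmodule.on lattice.
HB.instance Definition _ := Pointed.on lattice.
HB.instance Definition _ := @isMeasurable.Build default_measure_display
  lattice discrete_measurable discrete_measurable0
  discrete_measurableC discrete_measurableU.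

Definition coordinate (k : lattice) (r : 'I_d) : nat := (k : 'rV[nat]_d) ord0 r.

Definition norm1 (k : lattice) : nat := (\sum_(r < d) coordinate k r)%N.

End lattice.

(* Isomorphic, as a measurable space, to a complete separable metric space with
   its Borel sigma-algebra; a Hausdorff pseudometric is a metric. *)
Definition standard_borel (R : realType) dX (X : measurableType dX) : Prop :=
  exists Y : completePseudoMetricType R,
    [/\ hausdorff_space Y,
        exists2 D : set Y, countable D & dense D
      & exists2 f : X -> Y, bijective f &
          forall A : set X, measurable A <->
            exists2 B : set Y, <<s @open Y >> B & A = f @^-1` B].

Section processes.
Context (R : realType) dW (W : measurableType dW).

(* f is a version of the conditional probability of E given the
   sigma-algebra G; in every use below f is G-measurable by construction. *)
Definition is_cond_prob (Pr : probability W R) (G : set (set W)) (E : set W)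
    (f : W -> \bar R) : Prop :=
  forall H, G H -> Pr (H `&` E) = \int[Pr]_(w in H) f w.

Definition history dT (T : measurableType dT) (Z : nat -> W -> T) (n : nat) :
    set (set W) :=
  <<s \bigcup_(i in [set i | (i <= n)%N])
        preimage_set_system setT (Z i) measurable >>.

Definition markov_chain_from dX (X : measurableType dX)
    (P : X -> set X -> \bar R) (x : X)
    (Pr : probability W R) (J : nat -> {mfun W >-> X}) : Prop :=
  (forall A, measurable A -> Pr (J 0%N @^-1` A) = \d_x A) /\
  (forall n A, measurable A ->
    is_cond_prob Pr (history (fun i w => J i w) n) (J n.+1 @^-1` A)
      (fun w => P (J n w) A)).

End processes.

Section harris.
Context (R : realType) dX (X : measurableType dX).

Definition invariant_probability (P : X -> set X -> \bar R)
    (pi : probability X R) : Prop :=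
  forall A, measurable A -> \int[pi]_x P x A = pi A.

(* All realizations of the chain started from x have the same law, so
   quantifying over them amounts to a statement about P_x. *)
Definition harris_recurrent (P : X -> set X -> \bar R) : Prop :=
  exists2 phi : {sigma_finite_measure set X -> \bar R}, 0 < phi setT &
    forall A, measurable A -> 0 < phi A ->
    forall x dW (W : measurableType dW) (Pr : probability W R)
      (J : nat -> {mfun W >-> X}), markov_chain_from P x Pr J ->
      Pr (lim_sup_set (fun n => J n @^-1` A)) = 1.

Definition positive_harris (P : X -> set X -> \bar R) (pi : probability X R) :
    Prop :=
  harris_recurrent P /\ invariant_probability P pi.

End harris.

Section markov_renewal.
Context (R : realType) dX (X : measurableType dX) (d : nat).
Variable q : lattice d -> R.-ker X ~> X.

Definition markov_renewal_kernel : Prop :=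
  forall x, \esum_(k in [set: lattice d]) q k x setT = 1.

Definition strict_kernel : Prop := forall x A, measurable A -> q 0%R x A = 0.

Definition P_of (x : X) (A : set X) : \bar R :=
  \esum_(k in [set: lattice d]) q k x A.

(* On a rectangle A `*` B this is the sum of q k x A over k in B. *)
Definition Q_of (x : X) (E : set (X * lattice d)) : \bar R :=
  \esum_(k in [set: lattice d]) q k x (ysection E k).

Definition finite_positive_means (pi : probability X R) : Prop :=
  forall r : 'I_d,
    0 < \int[pi]_x (\esum_(k in [set: lattice d])
          ((coordinate k r)%:R%:E * q k x setT)) < +oo.

Definition joint_minorization (pi : probability X R) (C : set X) (eps : R)
    (theta : probability (X * lattice d)%type R) : Prop :=
  [/\ measurable C, 0 < pi C, (0 < eps <= 1)%R &
      forall x E, C x -> measurable E -> eps%:E * theta E <= Q_of x E].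

Definition exp_drift (C : set X) (V : X -> R) (th b eta : R) : Prop :=
  forall x, \esum_(k in [set: lattice d])
      \int[q k x]_y (expR (th * (1 + (norm1 k)%:R)) * V y)%:E
    <= (eta * V x + b * \1_C x)%:E.

Section split_chain.
Variables (C : set X) (eps : R) (theta : probability (X * lattice d)%type R).

(* Law of (J_{n+1}, X_{n+1}) given (J_n, chi_n) = z. For eps = 1 the second
   branch is the junk value 0; it is then only reached with probability 0. *)
Definition split_step (z : X * bool) (E : set (X * lattice d)) : \bar R :=
  if z.2 then theta E
  else if z.1 \in C then ((1 - eps)^-1)%:E * (Q_of z.1 E - eps%:E * theta E)
  else Q_of z.1 E.

Context dW (W : measurableType dW).
Variables (J : nat -> {mfun W >-> X}) (chi : nat -> {mfun W >-> bool}).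
(* xi n stands for X_{n+1}, the increment from S_n to S_{n+1}. *)
Variable xi : nat -> {mfun W >-> lattice d}.

Definition position (n : nat) (w : W) : lattice d := (\sum_(i < n) xi i w)%R.

Definition split_state (n : nat) (w : W) : X * bool * lattice d :=
  (J n w, chi n w, position n w).

Definition transition (n : nat) (w : W) : X * lattice d := (J n.+1 w, xi n w).

(* Under Pr, (J, chi, position) is the split chain started from its invariant
   probability restricted to the atom and normalized. *)
Definition split_chain_from_atom (pi : probability X R) (Pr : probability W R) :
    Prop :=
  [/\ forall A, measurable A ->
        Pr (J 0%N @^-1` A) = pi (A `&` C) * ((fine (pi C))^-1)%:E,
      Pr (chi 0%N @^-1` [set true]) = 1,
      forall n E, measurable E ->
        is_cond_prob Pr (history split_state n) (transition n @^-1` E)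
          (fun w => split_step (J n w, chi n w) E)
    & forall n,
        is_cond_prob Pr
          <<s history split_state n `|`
              preimage_set_system setT (transition n) measurable >>
          (chi n.+1 @^-1` [set true])
          (fun w => (eps * \1_C (J n.+1 w))%:E)].

Definition in_atom (n : nat) (w : W) : Prop := C (J n w) /\ chi n w.

(* The first return time T_1 = L_1 to the atom, +oo if there is no return. *)
Definition L1 (w : W) : \bar R :=
  ereal_inf [set n%:R%:E | n in [set n | (0 < n)%N /\ in_atom n w]].

(* T_1 as a natural number; 0 where T_1 = +oo. *)
Definition T1 (w : W) : nat := xget 0%N [set n | n%:R%:E = L1 w].

Definition Y1 (w : W) : lattice d := position (T1 w) w.

Definition reward (g : X * X * lattice d -> R) (n : nat) (w : W) : R :=
  g (J n w, J n.+1 w, xi n w).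

Definition R1_star (g : X * X * lattice d -> R) (w : W) : \bar R :=
  \sum_(0 <= n <oo | n%:R%:E < L1 w) (`|reward g n w|)%:E.

Definition cycle_reward (Pr : probability W R) (g : X * X * lattice d -> R)
    (u : lattice d) : \bar R :=
  \int[Pr]_w
    (\sum_(0 <= n < T1 w) reward g n w * \1_[set u] (position n w))%:E.

End split_chain.
End markov_renewal.

(* Main.v *)
(* Let theta' = p * th with p small, and G = 1 + delta * V with delta small.
   Convexity of exp gives, for u = 1 + |k|_1,
     exp(theta' u) G(y) <= (1 - p) + (p + delta) exp(th u) V(y),
   so the drift condition makes exp(theta' u) G contract by a factor rho < 1
   along a step from outside C. A visit of J to C ends the cycle with
   probability eps, and for p, delta small this loss outweighs the bounded
   factor paid for a step from C. Hence the weights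
     B_n = E[exp(theta' (n + 1 + |S_(n+1)|_1)) G(J_(n+1)); T_1 > n]
   satisfy B_(n+1) <= rho * B_n and are summable. The random series
     Phi = sum_n exp(theta' (n + 1 + |S_(n+1)|_1)) 1_{T_1 > n}
   is therefore integrable; it is +oo when there is no return, and up to
   constants it dominates pointwise every functional of the cycle in the
   theorem. *)
Require Import Defs.
From HB Require Import structures.
From mathcomp Require Import all_boot all_order all_algebra.
From mathcomp Require Import all_classical all_reals all_analysis.
From mathcomp Require Import measurable_realfun.
From mathcomp Require Import ring lra.

Set Implicit Arguments.
Unset Strict Implicit.
Unset Printing Implicit Defensive.

Import Order.TTheory GRing.Theory Num.Theory.
Import numFieldNormedType.Exports.
Import HBNNSimple.

Local Open Scope classical_set_scope.
Local Open Scope ring_scope.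
Local Open Scope ereal_scope.

(** * Integrals of nonnegative, possibly nonmeasurable functions *)

Section lower_integral.
Context (R : realType) d (T : measurableType d).
Variable mu : {measure set T -> \bar R}.

(** The integral of a nonnegative function is a supremum over the simple functions below it, and a
    larger function has more of these. The functionals of the cycle are later compared with their
    majorant in this way. *)
Lemma integral_mono (D : set T) (f g : T -> \bar R) :
  (forall x, D x -> 0 <= f x) -> (forall x, D x -> f x <= g x) ->
  \int[mu]_(x in D) f x <= \int[mu]_(x in D) g x.
Proof.
move=> f0 fg; rewrite integral_mkcond [leRHS]integral_mkcond.
have fD0 x : 0 <= (f \_ D) x by exact: erestrict_ge0.
have fgD x : (f \_ D) x <= (g \_ D) x.
  by rewrite /patch; case: ifPn => // /set_mem; exact: fg.
have gD0 x : 0 <= (g \_ D) x by exact: le_trans (fD0 x) (fgD x).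
rewrite !ge0_integralTE//; apply: ge_ereal_sup => _ [h hf <-].
by apply: ereal_sup_ubound; exists h => // x; exact: le_trans (hf x) (fgD x).
Qed.

(** The positive and the negative part are bounded separately, each by the integral of [g]; this is
    where the factor 2 comes from. *)
Lemma abse_integral_le (f g : T -> \bar R) : (forall x, `|f x| <= g x) ->
  `|\int[mu]_x f x| <= 2%:E * \int[mu]_x g x.
Proof.
move=> fg; rewrite integralE.
have fgp : \int[mu]_x f^\+ x <= \int[mu]_x g x.
  apply: integral_mono => x _; first exact: funepos_ge0.
  by rewrite (le_trans _ (fg x))// -/((abse \o f) x) fune_abse leeDl.
have fgn : \int[mu]_x f^\- x <= \int[mu]_x g x.
  apply: integral_mono => x _; first exact: funeneg_ge0.
  by rewrite (le_trans _ (fg x))// -/((abse \o f) x) fune_abse leeDr.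
have fp0 : 0 <= \int[mu]_x f^\+ x.
  by apply: integral_ge0 => x _; exact: funepos_ge0.
have fn0 : 0 <= \int[mu]_x f^\- x.
  by apply: integral_ge0 => x _; exact: funeneg_ge0.
have -> : 2%:E = (1 + 1)%E :> \bar R by [].
rewrite ge0_muleDl// !mul1e.
rewrite (le_trans (lee_abs_sub _ _))// !gee0_abs//.
exact: leeD.
Qed.

End lower_integral.

(** * Simple functions and bounds on conditional expectations *)

Section simple_functions.
Context (R : realType) d (T : measurableType d).
Implicit Type s : {nnsfun T >-> R}.

(* The absolute values make every term nonnegative, including the terms of
   the sums over all reals to which the library lemmas apply. *)
Definition level_sum s (m : set T -> \bar R) : \bar R :=
  \sum_(c <- finmap.enum_fset (fset_set (range s)))
    `|c|%:E * m (s @^-1` [set c]).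

Lemma sintegral_level_sum s (mu : {measure set T -> \bar R}) :
  sintegral mu s = level_sum s mu.
Proof.
rewrite sintegralE fsbig_finite//; apply: eq_big_seq => c.
by rewrite in_fset_set// inE => -[x _ <-]; rewrite ger0_norm.
Qed.

Lemma nnsfun_level_sum s x : (s x)%:E = level_sum s (fun A => (\1_A x)%:E).
Proof.
rewrite [in LHS]fimfunE fsbig_finite//= /level_sum -sumEFin.
apply: eq_big_seq => c; rewrite in_fset_set// inE => -[y _ <-].
by rewrite ger0_norm.
Qed.

Lemma level_sum_ge0 s m : (forall A, 0 <= m A) -> 0 <= level_sum s m.
Proof. by move=> m0; apply: sume_ge0 => c _; rewrite mule_ge0// lee_fin. Qed.

End simple_functions.

(** A simple function below [f] restricted to [H] vanishes off [H]. Its level sets at positive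
    values therefore lie in [H], where [mu] and its restriction agree. *)
Lemma integral_le_mrestr (R : realType) d (T : measurableType d)
    (mu : {measure set T -> \bar R}) (H : set T) (mH : measurable H)
    (f : T -> \bar R) : (forall x, 0 <= f x) ->
  \int[mu]_(x in H) f x <= \int[mrestr mu mH]_x f x.
Proof.
move=> f0; rewrite integral_mkcond.
have fH0 x : 0 <= (f \_ H) x by exact: erestrict_ge0.
rewrite !ge0_integralTE//; apply: ge_ereal_sup => _ [h hf <-].
apply: ereal_sup_ubound; exists h => [x/=|].
  rewrite (le_trans (hf x))// /patch; case: ifPn => // _.
rewrite !sintegralEnnsfun; apply: eq_fsbigr => c; rewrite inE/= => c0.
rewrite /mrestr setIidl// => x /= hx; apply/not_notP => Hx.
by have := hf x; rewrite /patch memNset// hx lee_fin leNgt c0.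
Qed.

Section disintegration.
Context (R : realType) dW (W : measurableType dW) d (T : measurableType d).
Variables (Pr : probability W R) (Z : W -> T) (H : set W).
Hypotheses (mZ : measurable_fun setT Z) (mH : measurable H).

Lemma integral_trans_le (k : W -> set T -> \bar R) (psi : T -> \bar R)
    (g : W -> \bar R) :
  (forall A, measurable A -> measurable_fun H (k ^~ A : W -> \bar R)) ->
  (forall w A, 0 <= k w A) ->
  (forall A, measurable A -> Pr (H `&` Z @^-1` A) <= \int[Pr]_(w in H) k w A) ->
  measurable_fun setT psi -> (forall z, 0 <= psi z) ->
  (forall (s : {nnsfun T >-> R}) w, (forall z, (s z)%:E <= psi z) -> H w ->
    level_sum s (k w) <= g w) ->
  \int[Pr]_(w in H) psi (Z w) <= \int[Pr]_(w in H) g w.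
Proof.
move=> mk k0 Prk mpsi psi0 kg.
(* Under the law of [Z] restricted to [H], the integral of [psi] is a supremum over simple
   functions, and each of them is treated level by level. *)
apply: (@le_trans _ _ (\int[pushforward (mrestr Pr mH) Z]_z psi z)).
  rewrite (ge0_integral_pushforward mZ)// preimage_setT.
  exact: integral_le_mrestr.
rewrite ge0_integralTE//; apply: ge_ereal_sup => _ [s spsi <-].
rewrite sintegral_level_sum.
apply: (@le_trans _ _ (\int[Pr]_(w in H) level_sum s (k w))).
  rewrite /level_sum ge0_integral_sum//; last 2 first.
  - by move=> c; apply: measurable_funeM; apply: mk.
  - by move=> c w _; rewrite mule_ge0// lee_fin.
  apply: lee_sum => c _; rewrite ge0_integralZl//; last by apply: mk.
  apply: lee_wpmul2l; first by rewrite lee_fin.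
  by have := Prk (s @^-1` [set c]); rewrite setIC; exact.
apply: integral_mono => w Hw; first exact: level_sum_ge0.
exact: kg.
Qed.

End disintegration.

(** * Fibrewise comparison and countable sums *)

(** An inequality that holds on every fiber of [N] survives multiplication by a nonnegative function
    of [N]: decompose over the countably many values and sum. This replaces taking a known factor
    out of a conditional expectation. *)
Lemma integral_fiber_le (R : realType) dW (W : measurableType dW)
    (Pr : {measure set W -> \bar R}) (N : W -> nat) (D1 D2 : set W)
    (f g : W -> \bar R) (c : nat -> R) :
  (forall m, measurable (N @^-1` [set m])) ->
  measurable D1 -> measurable D2 ->
  measurable_fun setT f -> measurable_fun setT g ->
  (forall w, 0 <= f w) -> (forall w, 0 <= g w) -> (forall m, (0 <= c m)%R) ->
  (forall m, \int[Pr]_(w in D1 `&` N @^-1` [set m]) f w <=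
             \int[Pr]_(w in D2 `&` N @^-1` [set m]) g w) ->
  \int[Pr]_(w in D1) ((c (N w))%:E * f w) <=
  \int[Pr]_(w in D2) ((c (N w))%:E * g w).
Proof.
move=> mN mD1 mD2 mf mg f0 g0 c0 fg.
have mc : measurable_fun setT (fun w => (c (N w))%:E).
  apply/measurable_EFinP; apply: (@measurableT_comp _ _ _ _ _ _ c) => //.
  move=> _ B _; rewrite setTI.
  rewrite (_ : N @^-1` B = \bigcup_(m in B) N @^-1` [set m]).
    by apply: bigcup_measurable => m _; exact: mN.
  by apply/seteqP; split=> [w Bw|w [m Bm /= ->//]]; exists (N w).
have split_fibers D (h : W -> \bar R) : measurable D -> measurable_fun setT h ->
    (forall w, 0 <= h w) -> \int[Pr]_(w in D) ((c (N w))%:E * h w) =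
    \sum_(m <oo) (c m)%:E * \int[Pr]_(w in D `&` N @^-1` [set m]) h w.
  move=> mD mh h0.
  have DE : D = \bigcup_m (D `&` N @^-1` [set m]).
    by apply/seteqP; split=> [w Dw|w [m _ []//]]; exists (N w).
  rewrite [in LHS]DE ge0_integral_bigcup//=.
  - apply: eq_eseriesr => m _.
    rewrite -ge0_integralZl//; last 3 first.
    + exact: measurableI.
    + exact: measurable_funTS.
    + by rewrite lee_fin.
    by apply: eq_integral => w; rewrite inE => -[_ /= ->].
  - by move=> m; exact: measurableI.
  - by apply: measurable_funTS; exact: emeasurable_funM.
  - by move=> w _; rewrite mule_ge0// lee_fin.
  - exact/trivIset_setIl/trivIset_preimage1.
rewrite !split_fibers//; apply: lee_nneseries => m.
  by move=> _ _; rewrite mule_ge0// ?lee_fin// integral_ge0.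
by move=> _; rewrite lee_wpmul2l// lee_fin.
Qed.

Lemma emeasurable_esum (R : realType) dT (T : measurableType dT)
    (K : countType) (k0 : K) (f : K -> T -> \bar R) :
  (forall k x, 0 <= f k x) -> (forall k, measurable_fun setT (f k)) ->
  measurable_fun setT (fun x => \esum_(k in [set: K]) f k x).
Proof.
move=> f0 mf.
(* Enumerate [K] by its codes. The value [k0] is a filler at integers that code nothing, and [P]
   excludes these from the sum. *)
pose e (n : nat) : K := odflt k0 (pickle_inv n).
pose P (n : nat) := isSome (pickle_inv n : option K).
have bij : set_bij [set n | P n] [set: K] e.
  split=> // [m n /set_mem /= Pm /set_mem /= Pn emn|k _].
    rewrite -[m](@pickle_invK K) -[n](@pickle_invK K).
    move: Pm Pn emn; rewrite /P /e.
    by case: pickle_inv => // ? _; case: pickle_inv => // ? _ /= ->.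
  by exists (pickle k); rewrite /P /e /= pickleK_inv.
under [X in measurable_fun _ X]funext => x.
  rewrite (reindex_esum _ _ _ _ bij) -nneseries_esum//.
  over.
exact: ge0_emeasurable_sum.
Qed.

(** * The lattice and the semi-Markov kernel *)

Section lattice.
Variable d : nat.

Lemma countable_lattice (A : set (lattice d)) : countable A.
Proof. exact: (@countableP 'rV[nat]_d). Qed.

(** For positive [c], move [c] to the other side and compare finite sums; [c = 0] is separate
    because of the division. *)
Lemma le_esumZ (R : realType) (f : lattice d -> \bar R) (c : R) :
  (0 <= c)%R -> (forall k, 0 <= f k) ->
  c%:E * (\esum_(k in [set: lattice d]) f k) <=
  \esum_(k in [set: lattice d]) (c%:E * f k).
Proof.
move=> c0 f0; have [->|c_neq0] := eqVneq c 0%R.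
  by rewrite mul0e esum_ge0// => k _; rewrite mul0e.
have cgt0 : (0 < c)%R by rewrite lt_neqAle eq_sym c_neq0.
rewrite -lee_pdivlMl//; apply: ge_ereal_sup => _ [F [finF _] <-].
rewrite lee_pdivlMl// ge0_mule_fsumr//.
by apply: ereal_sup_ubound; exists F.
Qed.

Lemma measurable_lattice_valued dW (W : measurableType dW)
    (f : W -> lattice d) :
  (forall k, measurable (f @^-1` [set k])) -> measurable_fun setT f.
Proof.
move=> mf _ B _; rewrite setTI.
rewrite (_ : _ @^-1` _ =
    \bigcup_k (if k \in B then f @^-1` [set k] else set0)).
  apply: countable_bigcupT_measurable => [|k]; first exact: countable_lattice.
  by case: ifPn.
apply/seteqP; split=> [w Bw|w [k _]].
  by exists (f w) => //; rewrite mem_set.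
by case: ifPn => // /set_mem Bk /= ->.
Qed.

Lemma norm1D (k l : lattice d) : norm1 (k + l)%R = (norm1 k + norm1 l)%N.
Proof.
rewrite /norm1 -big_split; apply: eq_bigr => r _.
by rewrite /coordinate [LHS]mxE.
Qed.

Lemma norm10 : norm1 (0%R : lattice d) = 0%N.
Proof. by rewrite /norm1 big1// => r _; rewrite /coordinate [LHS]mxE. Qed.

End lattice.

Section kernel.
Context (R : realType) dX (X : measurableType dX) (d : nat).
Variable q : lattice d -> R.-ker X ~> X.

Lemma Q_of_ge0 x E : 0 <= Q_of q x E.
Proof. by apply: esum_ge0. Qed.

Lemma measurable_Q_of E : measurable E -> measurable_fun setT (Q_of q ^~ E).
Proof.
move=> mE; apply: (@emeasurable_esum _ _ _ 'rV[nat]_d 0%R) => // k.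
exact/measurable_kernel/measurable_ysection.
Qed.

(** Lets [Q_of q x] act as a measure on pairs without building it as one: the finite sum over levels
    is exchanged with the sum over [k], and for fixed [k] the level sum is the integral of the
    section of [s] at [k]. *)
Lemma level_sum_Q_of_le (s : {nnsfun (X * lattice d) >-> R})
    (psi : X * lattice d -> \bar R) x : (forall z, (s z)%:E <= psi z) ->
  level_sum s (Q_of q x) <=
    \esum_(k in [set: lattice d]) \int[q k x]_y psi (y, k).
Proof.
move=> spsi.
apply: (@le_trans _ _ (\esum_(k in [set: lattice d])
    level_sum s (fun E => q k x (ysection E k)))).
  rewrite /level_sum esum_sum; last by move=> *; rewrite mule_ge0// lee_fin.
  by apply: lee_sum => c _; exact: le_esumZ.
apply: le_esum => k _.
have -> : level_sum s (fun E => q k x (ysection E k)) =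
    \int[q k x]_y (s (y, k))%:E.
  have ms c : measurable (ysection (s @^-1` [set c]) k).
    exact: measurable_ysection.
  have indE c y : \1_(s @^-1` [set c]) (y, k) =
      \1_(ysection (s @^-1` [set c]) k) y :> R.
    by rewrite !indicE mem_ysection.
  have mind c : measurable_fun setT
      (fun y => (\1_(ysection (s @^-1` [set c]) k) y)%:E : \bar R).
    exact/measurable_EFinP/measurable_indic.
  under eq_integral do rewrite nnsfun_level_sum /level_sum.
  rewrite ge0_integral_sum//; last first.
    by move=> c; under eq_fun do rewrite indE; exact: measurable_funeM.
  rewrite /level_sum; apply: eq_bigr => c _.
  under eq_integral do rewrite indE.
  by rewrite ge0_integralZl// ?lee_fin// integral_indic// setIT.
apply: integral_mono => y _ //.
by rewrite lee_fin.
Qed.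

End kernel.

(** * Events of the split chain *)

Section generated_sigma_algebra.
Context (T : pointedType) (G : set (set T)).

Lemma sigma_setI A B : <<s G >> A -> <<s G >> B -> <<s G >> (A `&` B).
Proof. exact: (@measurableI _ (g_sigma_algebraType G)). Qed.

Lemma sigma_setC A : <<s G >> A -> <<s G >> (~` A).
Proof. exact: (@measurableC _ (g_sigma_algebraType G)). Qed.

Lemma sigma_bigcup (F : nat -> set T) :
  (forall i, <<s G >> (F i)) -> <<s G >> (\bigcup_i F i).
Proof.
exact: (@bigcupT_measurable _ (g_sigma_algebraType G)).
Qed.

Lemma sigma_setT : <<s G >> setT.
Proof. exact: (@measurableT _ (g_sigma_algebraType G)). Qed.

End generated_sigma_algebra.

Section split_paths.
Context (R : realType) dX (X : measurableType dX) (d : nat).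
Context dW (W : measurableType dW).
Variables (C : set X) (J : nat -> {mfun W >-> X}).
Variable chi : nat -> {mfun W >-> bool}.
Variable xi : nat -> {mfun W >-> lattice d}.
Hypothesis mC : measurable C.

Local Notation past := (history (split_state J chi xi)).
Local Notation past_trans n := (<<s past n `|`
  preimage_set_system setT (transition J xi n) measurable >>).

Definition length_at n w := norm1 (position xi n w).

(** The event $T_1>n$; time 0, at which the chain sits in the atom, is not counted. *)
Definition no_return n : set W :=
  [set w | forall i, (0 < i <= n)%N -> ~ in_atom C J chi i w].

Lemma position0 w : position xi 0 w = 0%R.
Proof. by rewrite /position big_ord0. Qed.

Lemma positionS n w : position xi n.+1 w = (position xi n w + xi n w)%R.
Proof. by rewrite /position big_ord_recr. Qed.

Lemma length_atS n w : length_at n.+1 w = (length_at n w + norm1 (xi n w))%N.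
Proof. by rewrite /length_at positionS norm1D. Qed.

Lemma length_at_sum n w : length_at n w = (\sum_(i < n) norm1 (xi i w))%N.
Proof.
elim: n => [|n IH]; first by rewrite big_ord0 /length_at position0 norm10.
by rewrite big_ord_recr -IH length_atS.
Qed.

Lemma no_return0 : no_return 0 = setT.
Proof. by apply/seteqP; split=> // w _ [|i]. Qed.

Lemma no_returnS n :
  no_return n.+1 = no_return n `&` ~` [set w | in_atom C J chi n.+1 w].
Proof.
apply/seteqP; split=> [w nrw|w [nrw nr1] i /andP[i0]].
  split=> [i /andP[i0 lein]|]; apply: nrw; last by rewrite leqnn.
  by rewrite i0 leqW.
rewrite leq_eqVlt => /predU1P[->//|]; rewrite ltnS => lein.
by apply: nrw; rewrite i0.
Qed.

Lemma measurable_position n : measurable_fun setT (position xi n).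
Proof.
elim: n => [|n mS].
  rewrite (_ : position xi 0 = cst 0%R)//.
  by apply/funext => w; exact: position0.
apply: measurable_lattice_valued => k.
rewrite (_ : _ @^-1` _ = \bigcup_(l : lattice d)
    ((position xi n @^-1` [set l]) `&` (xi n @^-1` [set m | (l + m)%R = k]))).
  apply: countable_bigcupT_measurable => [|l]; first exact: countable_lattice.
  by apply: measurableI; [rewrite -[_ @^-1` _]setTI; exact: mS
                         |exact: measurable_funPTI].
apply/seteqP; split=> [w /= <-|w [l _ [/= <- <-]]]; last by rewrite positionS.
by exists (position xi n w) => //; split=> //=; rewrite positionS.
Qed.

Lemma measurable_length_at n m : measurable (length_at n @^-1` [set m]).
Proof.
rewrite (_ : _ @^-1` _ = position xi n @^-1` [set k | norm1 k = m])//.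
by rewrite -[_ @^-1` _]setTI; exact: measurable_position.
Qed.

Lemma measurable_split_state n : measurable_fun setT (split_state J chi xi n).
Proof.
apply/measurable_fun_pairP; split => /=.
  by apply/measurable_fun_pairP; split => /=; exact: measurable_funPT.
exact: measurable_position.
Qed.

Lemma measurable_transition n : measurable_fun setT (transition J xi n).
Proof. by apply/measurable_fun_pairP; split => /=; exact: measurable_funPT. Qed.

Lemma past_measurable n : past n `<=` measurable.
Proof.
apply: smallest_sub; first exact: sigma_algebra_measurable.
move=> _ [i _ [B mB <-]]; exact: measurable_split_state.
Qed.

Lemma past_trans_measurable n : past_trans n `<=` measurable.
Proof.
apply: smallest_sub; first exact: sigma_algebra_measurable.
move=> A [|[B mB <-]]; first exact: past_measurable.
exact: measurable_transition.
Qed.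

Lemma past_state i n B : (i <= n)%N -> measurable B ->
  past n (split_state J chi xi i @^-1` B).
Proof.
move=> lein mB; apply: sub_sigma_algebra; exists i => //.
by exists B => //; rewrite setTI.
Qed.

Lemma past_mono m n : (m <= n)%N -> past m `<=` past n.
Proof.
move=> lemn; apply: sub_smallest2r; first exact: smallest_sigma_algebra.
by move=> A [i /= im mA]; exists i => //=; exact: leq_trans lemn.
Qed.

Lemma past_J i n B : (i <= n)%N -> measurable B -> past n (J i @^-1` B).
Proof.
move=> lein mB; rewrite (_ : _ @^-1` _ =
  split_state J chi xi i @^-1` ((B `*` setT) `*` setT)).
  by apply: past_state => //; apply: measurableX => //; exact: measurableX.
by apply/seteqP; split=> w //= [[]].
Qed.

Lemma past_chi i n b : (i <= n)%N -> past n (chi i @^-1` [set b]).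
Proof.
move=> lein; rewrite (_ : _ @^-1` _ =
  split_state J chi xi i @^-1` ((setT `*` [set b]) `*` setT)).
  by apply: past_state => //; apply: measurableX => //; exact: measurableX.
by apply/seteqP; split=> w //= [[]].
Qed.

Lemma past_length_at i n m : (i <= n)%N ->
  past n (length_at i @^-1` [set m]).
Proof.
move=> lein; rewrite (_ : _ @^-1` _ =
  split_state J chi xi i @^-1` (setT `*` [set k | norm1 k = m])).
  by apply: past_state => //; apply: measurableX.
by apply/seteqP; split=> w //= [].
Qed.

Lemma past_in_atom i n : (i <= n)%N -> past n [set w | in_atom C J chi i w].
Proof.
move=> lein; rewrite (_ : [set w | _] =
  (J i @^-1` C) `&` (chi i @^-1` [set true])).
  by apply: sigma_setI; [exact: past_J|exact: past_chi].
by [].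
Qed.

Lemma past_no_return n : past n (no_return n).
Proof.
elim: n => [|n IH]; first by rewrite no_return0; exact: sigma_setT.
rewrite no_returnS; apply: sigma_setI; first exact: past_mono IH.
by apply: sigma_setC; exact: past_in_atom.
Qed.

Lemma past_sub_past_trans n : past n `<=` past_trans n.
Proof. by move=> A pA; apply: sub_sigma_algebra; left. Qed.

Lemma past_trans_trans n B : measurable B ->
  past_trans n (transition J xi n @^-1` B).
Proof.
move=> mB; apply: sub_sigma_algebra; right.
by exists B => //; rewrite setTI.
Qed.

Lemma past_trans_J n B : measurable B -> past_trans n (J n.+1 @^-1` B).
Proof.
move=> mB; rewrite (_ : _ @^-1` _ = transition J xi n @^-1` (B `*` setT)).
  by apply: past_trans_trans; exact: measurableX.
by apply/seteqP; split=> w //= [].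
Qed.

(** $|S_{n+1}|_1$ is known once the transition is known, before the coin [chi n.+1]. Events on it
    may thus be used as conditions when the coin is tossed. *)
Lemma past_trans_length_at n m :
  past_trans n (length_at n.+1 @^-1` [set m]).
Proof.
rewrite (_ : _ @^-1` _ = \bigcup_i ((length_at n @^-1` [set i]) `&`
    (transition J xi n @^-1` (setT `*` [set k | (i + norm1 k)%N = m])))).
  apply: sigma_bigcup => i; apply: sigma_setI.
    by apply: past_sub_past_trans; exact: past_length_at.
  by apply: past_trans_trans; exact: measurableX.
apply/seteqP; split=> [w /= <-|w [i _ [/= <- [_ <-]]]].
  by exists (length_at n w) => //; split=> //=; rewrite length_atS.
by rewrite length_atS.
Qed.

End split_paths.

(** * Drift of the split chain *)

(** Convexity of exp between 0 and [a]: the tangent at [p * a] lies below exp at both endpoints, and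
    its linear terms cancel in the average with weights [p] and [1 - p]. *)
Lemma expR_le_chord (R : realType) (p a : R) : (0 <= p <= 1)%R ->
  (expR (p * a) <= 1 - p + p * expR a)%R.
Proof.
move=> /andP[p0 p1].
have tangent (u v : R) : (expR u * (1 + (v - u)) <= expR v)%R.
  rewrite -[v in leRHS](subrKC u) expRD ler_pM2l ?expR_gt0//.
  exact: expR_ge1Dx.
have q0 : (0 <= 1 - p)%R by rewrite subr_ge0.
have := lerD (ler_wpM2l p0 (tangent (p * a)%R a))
  (ler_wpM2l q0 (tangent (p * a)%R 0%R)).
rewrite expR0 mulr1 [leRHS]addrC; apply: le_trans.
by rewrite le_eqVlt; apply/orP; left; apply/eqP; ring.
Qed.

Section drift.
Context (R : realType) dX (X : measurableType dX) (d : nat).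
Context dW (W : measurableType dW).
Variables (q : lattice d -> R.-ker X ~> X) (C : set X) (eps : R).
Variable theta : probability (X * lattice d)%type R.
Variables (V : X -> R) (th b eta K : R).
Variables (J : nat -> {mfun W >-> X}) (chi : nat -> {mfun W >-> bool}).
Variables (xi : nat -> {mfun W >-> lattice d}) (Pr : probability W R).
Hypotheses (mC : measurable C) (eps_gt0 : (0 < eps)%R) (eps_le1 : (eps <= 1)%R).
Hypothesis minorization : forall x E, C x -> measurable E ->
  eps%:E * theta E <= Q_of q x E.
Hypotheses (mV : measurable_fun setT V) (V_ge1 : forall x, (1 <= V x)%R).
Hypotheses (drift : exp_drift q C V th b eta) (eta_ge0 : (0 <= eta)%R).
Hypothesis drift_C : forall x, C x -> (eta * V x + b <= K)%R.

Local Notation past := (history (split_state J chi xi)).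
Local Notation past_trans n := (<<s past n `|`
  preimage_set_system setT (transition J xi n) measurable >>).

Hypothesis step : forall n E, measurable E ->
  is_cond_prob Pr (past n) (transition J xi n @^-1` E)
    (fun w => split_step q C eps theta (J n w, chi n w) E).
Hypothesis coin : forall n, is_cond_prob Pr (past_trans n)
  (chi n.+1 @^-1` [set true]) (fun w => (eps * \1_C (J n.+1 w))%:E).

Definition drift_weight (z : X * lattice d) : R :=
  (expR (th * (1 + (norm1 z.2)%:R)) * V z.1)%R.

Let V_ge0 x : (0 <= V x)%R. Proof. exact: le_trans (V_ge1 x). Qed.

Lemma measurable_norm1_comp (f : nat -> R) :
  measurable_fun setT (fun z : X * lattice d => f (norm1 z.2)).
Proof.
exact: (@measurableT_comp _ _ _ _ _ _ (fun k : lattice d => f (norm1 k))).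
Qed.

Lemma measurable_drift_weight : measurable_fun setT drift_weight.
Proof.
apply: measurable_funM; last exact: measurableT_comp.
exact: (measurable_norm1_comp (fun m => expR (th * (1 + m%:R)))).
Qed.

Lemma split_step_ge0 z E : measurable E ->
  0 <= split_step q C eps theta z E.
Proof.
move=> mE; rewrite /split_step; case: ifP => // _.
case: ifPn => [/set_mem zC|_]; last exact: Q_of_ge0.
rewrite mule_ge0 ?lee_fin ?invr_ge0 ?subr_ge0// sube_ge0 ?minorization//.
by rewrite fin_numM// fin_num_measure.
Qed.

Lemma split_step_le_atom x E : measurable E -> C x ->
  split_step q C eps theta (x, true) E <= (eps^-1)%:E * Q_of q x E.
Proof. by move=> mE Cx; rewrite lee_pdivlMl//; exact: minorization. Qed.

(** Drop the subtracted multiple of [theta]. For [eps = 1] both sides are 0, because the inverse of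
    0 is 0. *)
Lemma split_step_le_C x E : C x ->
  split_step q C eps theta (x, false) E <= ((1 - eps)^-1)%:E * Q_of q x E.
Proof.
move=> Cx; rewrite /split_step/= mem_set// lee_wpmul2l//.
  by rewrite lee_fin invr_ge0 subr_ge0.
by rewrite -[leRHS]sube0 leeB// mule_ge0// lee_fin ltW.
Qed.

Lemma split_step_notC x E : ~ C x ->
  split_step q C eps theta (x, false) E = Q_of q x E.
Proof. by move=> Cx; rewrite /split_step/= memNset. Qed.

(** The constant [a] compares the split kernel with [Q_of]: it will be 1 outside [C], [(1 - eps)^-1]
    on [C] after coin 0, and [eps^-1] in the atom. The drift condition then applies to [Q_of]. *)
Lemma integral_drift_weight_le n (H : set W) (a : R) (g : W -> R) :
  past n H -> (0 <= a)%R ->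
  (forall w E, H w -> measurable E ->
    split_step q C eps theta (J n w, chi n w) E <= a%:E * Q_of q (J n w) E) ->
  (forall w, H w -> (eta * V (J n w) + b * \1_C (J n w) <= g w)%R) ->
  \int[Pr]_(w in H) (drift_weight (transition J xi n w))%:E <=
  \int[Pr]_(w in H) (a * g w)%:E.
Proof.
move=> pastH a0 stepH driftH.
pose k w E := a%:E * Q_of q (J n w) E.
have mH : measurable H by exact: past_measurable pastH.
apply: (@integral_trans_le _ _ _ _ _ Pr _ H _ mH k
          (fun z => (drift_weight z)%:E)).
- exact: measurable_transition.
- move=> E mE; apply: measurable_funTS; apply: measurable_funeM.
  by apply: (measurableT_comp (measurable_Q_of q mE)).
- by move=> w E; rewrite mule_ge0// ?lee_fin// Q_of_ge0.
- move=> E mE; rewrite step//; apply: integral_mono => w Hw.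
    exact: split_step_ge0.
  exact: stepH.
- by apply/measurable_EFinP; exact: measurable_drift_weight.
- by move=> z; rewrite lee_fin mulr_ge0// expR_ge0.
move=> s w sle Hw.
have -> : level_sum s (k w) = a%:E * level_sum s (Q_of q (J n w)).
  rewrite /level_sum ge0_sume_distrr; last first.
    by move=> c _; rewrite mule_ge0 ?lee_fin// Q_of_ge0.
  by apply: eq_bigr => c _; rewrite muleCA.
rewrite EFinM lee_wpmul2l ?lee_fin//.
apply: (le_trans (level_sum_Q_of_le _ _ sle)).
by apply: (le_trans (drift _)); rewrite lee_fin driftH.
Qed.

(** * Tamed weights and one-step contraction *)

Variables (p delta rho : R).
Hypotheses (p_itv : (0 <= p <= 1)%R) (delta_ge0 : (0 <= delta)%R).
(** From outside [C], the first two inequalities give $(1-p)+(p+\delta)\eta V\le\rho(1+\delta V)$.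
    The third serves on [C], where [1 - eps] is the probability that the cycle goes on. *)
Hypothesis rho_ge : (1 - p <= rho)%R.
Hypothesis contraction_notC : ((p + delta) * eta <= rho * delta)%R.
Hypothesis contraction_C :
  ((1 - p) * (1 - eps) + (p + delta) * K <= rho)%R.

Definition tamed_V (x : X) : R := (1 + delta * V x)%R.

Definition tamed_weight (z : X * lattice d) : R :=
  (expR (p * th * (1 + (norm1 z.2)%:R)) * tamed_V z.1)%R.

Lemma tamed_V_ge1 x : (1 <= tamed_V x)%R.
Proof. by rewrite lerDl mulr_ge0. Qed.

Let tamed_V_ge0 x : (0 <= tamed_V x)%R.
Proof. exact: le_trans (tamed_V_ge1 x). Qed.

Let p_ge0 : (0 <= p)%R. Proof. by case/andP: p_itv. Qed.
Let q_ge0 : (0 <= 1 - p)%R. Proof. by case/andP: p_itv; rewrite subr_ge0. Qed.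
Let pdelta_ge0 : (0 <= p + delta)%R. Proof. exact: addr_ge0. Qed.
Let rho_ge0 : (0 <= rho)%R. Proof. exact: le_trans rho_ge. Qed.

Lemma measurable_tamed_V : measurable_fun setT tamed_V.
Proof. by apply: measurable_funD => //; exact: measurable_funM. Qed.

Lemma measurable_tamed_weight : measurable_fun setT tamed_weight.
Proof.
apply: measurable_funM.
  exact: (measurable_norm1_comp (fun m => expR (p * th * (1 + m%:R)))).
by apply: (measurableT_comp measurable_tamed_V).
Qed.

Lemma tamed_weight_ge0 z : (0 <= tamed_weight z)%R.
Proof. by rewrite mulr_ge0// expR_ge0. Qed.

Hypothesis th_ge0 : (0 <= th)%R.

(** Expand [1 + delta * V]. The term 1 is bounded by the chord, with $V\ge1$ inserted only in its
    exponential part, so that the constant [1 - p] stays free of [V]; the term in [delta] uses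
    $p\le1$. *)
Lemma tamed_weight_le z :
  (tamed_weight z <= 1 - p + (p + delta) * drift_weight z)%R.
Proof.
rewrite /tamed_weight /drift_weight /tamed_V.
set u := (1 + _)%R; rewrite -mulrA.
have u0 : (0 <= th * u)%R by rewrite mulr_ge0// addr_ge0.
have chord := expR_le_chord (th * u) p_itv.
have le_exp : (expR (p * (th * u)) <= expR (th * u))%R.
  by rewrite ler_expR ler_piMl//; case/andP: p_itv.
have E0 := expR_ge0 (th * u); have V1 := V_ge1 z.1.
rewrite mulrDr mulr1 [((p + _) * _)%R]mulrDl addrA lerD//.
  by rewrite (le_trans chord)// lerD2l ler_wpM2l// ler_peMr.
by rewrite mulrCA ler_wpM2l// ler_wpM2r.
Qed.

Lemma integral_tamed_weight_le n (H : set W) (a : R) (g : W -> R) :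
  past n H -> (0 <= a)%R ->
  (forall w E, H w -> measurable E ->
    split_step q C eps theta (J n w, chi n w) E <= a%:E * Q_of q (J n w) E) ->
  measurable_fun setT g -> (forall w, (0 <= g w)%R) ->
  (forall w, H w -> (eta * V (J n w) + b * \1_C (J n w) <= g w)%R) ->
  \int[Pr]_(w in H) (tamed_weight (transition J xi n w))%:E <=
  \int[Pr]_(w in H) (1 - p + (p + delta) * (a * g w))%:E.
Proof.
move=> pastH a0 stepH mg g0 driftH.
have mH : measurable H by exact: past_measurable pastH.
have affine (h : W -> R) : measurable_fun setT h -> (forall w, 0 <= h w)%R ->
    \int[Pr]_(w in H) (1 - p + (p + delta) * h w)%:E =
    (1 - p)%:E * Pr H + (p + delta)%:E * \int[Pr]_(w in H) (h w)%:E.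
  move=> mh h0; under eq_integral do rewrite EFinD EFinM.
  rewrite ge0_integralD//.
  - by rewrite integral_cst// ge0_integralZl_EFin//;
      [move=> w _; rewrite lee_fin|
       apply: measurable_funTS; exact/measurable_EFinP].
  - by move=> w _; rewrite mule_ge0// lee_fin.
  - by apply: measurable_funTS; apply: measurable_funeM; exact/measurable_EFinP.
apply: (@le_trans _ _ (\int[Pr]_(w in H)
    (1 - p + (p + delta) * drift_weight (transition J xi n w))%:E)).
  apply: integral_mono => w _; first by rewrite lee_fin tamed_weight_ge0.
  by rewrite lee_fin tamed_weight_le.
rewrite !affine//.
- rewrite leeD2l// lee_wpmul2l ?lee_fin//.
  exact: integral_drift_weight_le stepH driftH.
- by apply: measurable_funM.
- by move=> w; rewrite mulr_ge0.
- apply: (measurableT_comp measurable_drift_weight).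
  exact: measurable_transition.
- by move=> w; rewrite mulr_ge0// expR_ge0.
Qed.

Lemma coin_notC n D : past_trans n D ->
  Pr (D `&` J n.+1 @^-1` (~` C) `&` chi n.+1 @^-1` [set true]) = 0.
Proof.
move=> pD; rewrite coin; last first.
  by apply: sigma_setI => //; apply: past_trans_J => //; exact: measurableC.
under eq_integral => w /set_mem [_ /= nC].
  rewrite indicE memNset// mulr0; over.
by rewrite integral0.
Qed.

(** [D] may involve the transition but not the coin, so given [D] and a landing in [C] the coin
    shows 1 with probability [eps]; take complements. *)
Lemma coin_C n D : past_trans n D ->
  Pr (D `&` J n.+1 @^-1` C `&` chi n.+1 @^-1` [set false]) =
  (1 - eps)%:E * Pr (D `&` J n.+1 @^-1` C).
Proof.
move=> pD; set A := D `&` _.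
have pA : past_trans n A by apply: sigma_setI => //; exact: past_trans_J.
have mA : measurable A by exact: past_trans_measurable pA.
have PrA : Pr (A `&` chi n.+1 @^-1` [set true]) = eps%:E * Pr A.
  rewrite coin//; under eq_integral => w /set_mem [_ /= wC].
    rewrite indicE mem_set// mulr1; over.
  by rewrite integral_cst.
have -> : chi n.+1 @^-1` [set false] = ~` (chi n.+1 @^-1` [set true]).
  by apply/seteqP; split=> w /=; case: (chi n.+1 w).
rewrite -setDE measureD//; last 2 first.
- by rewrite -[_ @^-1` _]setTI; exact: measurable_funP.
- by rewrite -ge0_fin_numE// fin_num_measure.
rewrite [X in _ - X](_ : _ = eps%:E * Pr A); last exact: PrA.
by rewrite EFinB muleBl ?mul1e// fin_num_measure.
Qed.

Lemma tamed_step_notC n (H : set W) : past n H ->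
  H `<=` J n @^-1` (~` C) -> H `<=` chi n @^-1` [set false] ->
  \int[Pr]_(w in H) (tamed_weight (transition J xi n w))%:E <=
  \int[Pr]_(w in H) (rho * tamed_V (J n w))%:E.
Proof.
move=> pH HC Hchi.
apply: (le_trans (@integral_tamed_weight_le n H 1
    (fun w => eta * V (J n w))%R pH ler01 _ _ _ _)).
- by move=> w E Hw mE; rewrite mul1e (Hchi _ Hw) split_step_notC//; exact: HC.
- by apply: measurable_funM => //; apply: (measurableT_comp mV).
- by move=> w; rewrite mulr_ge0.
- by move=> w Hw; rewrite indicE memNset ?mulr0 ?addr0//; exact: HC.
apply: integral_mono => w Hw; rewrite lee_fin.
  by rewrite addr_ge0// mulr_ge0// mul1r mulr_ge0.
rewrite mul1r mulrA /tamed_V mulrDr mulr1 mulrA lerD//.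
by rewrite ler_wpM2r.
Qed.

(** The factor [(1 - eps)^-1] of the residual kernel cancels against the probability [1 - eps] of
    coin 0, while the constant term [1 - p] keeps the factor [1 - eps]. That loss gives the
    contraction on [C]. *)
Lemma tamed_step_C n D : past_trans n D -> past n.+1 D ->
  \int[Pr]_(w in D `&` J n.+1 @^-1` C `&` chi n.+1 @^-1` [set false])
    (tamed_weight (transition J xi n.+1 w))%:E <=
  \int[Pr]_(w in D `&` J n.+1 @^-1` C) (rho * tamed_V (J n.+1 w))%:E.
Proof.
move=> pD pD1; set A := D `&` _; set H := A `&` _.
have pA : past n.+1 A by apply: sigma_setI => //; exact: past_J.
have mA : measurable A by exact: past_measurable pA.
have pH : past n.+1 H by apply: sigma_setI => //; exact: past_chi.
have mH : measurable H by exact: past_measurable pH.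
(* A point of [A] lies over [C], where [K] dominates the nonnegative left side of the drift
   condition. If [A] is empty, both integrals are treated directly. *)
have K0 w : A w -> (0 <= K)%R.
  move=> [_ Cw]; rewrite (le_trans _ (drift_C Cw))//.
  have := drift (J n.+1 w); rewrite indicE mem_set// mulr1 -lee_fin.
  by apply: le_trans; apply: esum_ge0 => k _; apply: integral_ge0 => y _;
    rewrite lee_fin mulr_ge0// expR_ge0.
have [[w0 /K0 {}K0]|A0] := pselect (A !=set0); last first.
  have -> : H = set0 by apply/seteqP; split=> // w [Aw _]; apply: A0; exists w.
  by rewrite integral_set0 integral_ge0// => w _; rewrite lee_fin mulr_ge0.
have ieps0 : (0 <= (1 - eps)^-1)%R by rewrite invr_ge0 subr_ge0.
apply: (le_trans (@integral_tamed_weight_le n.+1 H (1 - eps)^-1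
    (cst K) pH ieps0 _ _ _ _)) => //.
- by move=> w E [[_ Cw] ->] _; exact: split_step_le_C.
- by move=> w [[_ Cw] _]; rewrite indicE mem_set// mulr1; exact: drift_C.
rewrite /= integral_cst//.
rewrite [X in _ * X <= _](_ : _ = (1 - eps)%:E * Pr A); last exact: coin_C.
apply: (@le_trans _ _ (\int[Pr]_(w in A) rho%:E)).
  rewrite integral_cst// muleA lee_wpmul2r// -EFinM lee_fin.
  rewrite (le_trans _ contraction_C)// mulrDl lerD2l//.
  rewrite -[leRHS]mulr1 -!mulrA ler_wpM2l//.
  rewrite [leLHS]mulrCA ler_wpM2l//.
  (* The product of [1 - eps] and its inverse is 1, except for [eps = 1], where it is 0; both are at
     most 1. *)
  have [->|eps_neq1] := eqVneq eps 1%R; first by rewrite subrr mulr0.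
  by rewrite mulVf// subr_eq0 eq_sym.
apply: integral_mono => w _; rewrite lee_fin//.
by rewrite ler_peMr// tamed_V_ge1.
Qed.

(** Without a return at time [n.+1] there are three cases: outside [C] with coin 0, outside [C] with
    coin 1, which is a null event, and in [C] with coin 0. [D] belongs to both sigma-algebras
    because the coin law is conditioned on the first and the next transition on the second. *)
Lemma tamed_step n D : past_trans n D -> past n.+1 D ->
  \int[Pr]_(w in D `&` ~` [set w | in_atom C J chi n.+1 w])
    (tamed_weight (transition J xi n.+1 w))%:E <=
  \int[Pr]_(w in D) (rho * tamed_V (J n.+1 w))%:E.
Proof.
move=> pD pD1.
have mD : measurable D by exact: past_measurable pD1.
have mCC : measurable (~` C) by exact: measurableC.
pose D1 := D `&` J n.+1 @^-1` (~` C); pose D2 := D `&` J n.+1 @^-1` C.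
pose H1 := D1 `&` chi n.+1 @^-1` [set false].
pose H0 := D1 `&` chi n.+1 @^-1` [set true].
pose H2 := D2 `&` chi n.+1 @^-1` [set false].
have pD1' : past n.+1 D1 by apply: sigma_setI => //; exact: past_J.
have pD2' : past n.+1 D2 by apply: sigma_setI => //; exact: past_J.
have pH1 : past n.+1 H1 by apply: sigma_setI => //; exact: past_chi.
have pH0 : past n.+1 H0 by apply: sigma_setI => //; exact: past_chi.
have pH2 : past n.+1 H2 by apply: sigma_setI => //; exact: past_chi.
have [mD1 mD2] : measurable D1 /\ measurable D2.
  by split; [exact: past_measurable pD1'|exact: past_measurable pD2'].
have mH1 : measurable H1 by exact: past_measurable pH1.
have mH0 : measurable H0 by exact: past_measurable pH0.
have mH2 : measurable H2 by exact: past_measurable pH2.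
have HE : D `&` ~` [set w | in_atom C J chi n.+1 w] = H1 `|` H0 `|` H2.
  apply/seteqP; split=> [w [Dw /= naw]|w [[|]|]].
  - have [Cw|nCw] := pselect (C (J n.+1 w)).
      right; split=> //=; apply/negbTE/negP => chiw; exact: naw.
    by left; case chiw: (chi n.+1 w); [right|left].
  - by move=> [[Dw nCw] _]; split=> // -[].
  - by move=> [[Dw nCw] _]; split=> // -[].
  - by move=> [[Dw Cw] /= chiw]; split=> // -[_]; rewrite chiw.
have DE : D = D1 `|` D2.
  by apply/seteqP; split=> [w Dw|w [[]|[]]//];
    have [|] := pselect (C (J n.+1 w)); [right|left].
have mf A : measurable_fun A
    (fun w => (tamed_weight (transition J xi n.+1 w))%:E : \bar R).
  apply: measurable_funTS; apply/measurable_EFinP.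
  apply: (measurableT_comp measurable_tamed_weight).
  exact: measurable_transition.
have mg A : measurable_fun A (fun w => (rho * tamed_V (J n.+1 w))%:E : \bar R).
  apply: measurable_funTS; apply/measurable_EFinP; apply: measurable_funM => //.
  exact: (measurableT_comp measurable_tamed_V).
have f0 w : 0 <= (tamed_weight (transition J xi n.+1 w))%:E.
  by rewrite lee_fin tamed_weight_ge0.
have g0 w : 0 <= (rho * tamed_V (J n.+1 w))%:E by rewrite lee_fin mulr_ge0.
have mH10 : measurable (H1 `|` H0) by exact: measurableU.
have disj_H10_H2 : [disjoint H1 `|` H0 & H2].
  apply/disj_setPS => w [[[[_ nC] _]|[[_ nC] _]] [[_ Cw] _]]; exact: nC.
have disj_H1_H0 : [disjoint H1 & H0].
  by apply/disj_setPS => w [[_ /= chi0] [_ /=]]; rewrite chi0.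
have disj_D1_D2 : [disjoint D1 & D2].
  apply/disj_setPS => w [[_ nC] [_ Cw]]; exact: nC.
rewrite HE [in leRHS]DE !ge0_integral_setU//.
rewrite (@null_set_integral _ _ _ Pr H0)//; last exact: coin_notC.
rewrite adde0 leeD//; last exact: tamed_step_C.
apply: (@le_trans _ _ (\int[Pr]_(w in H1) (rho * tamed_V (J n.+1 w))%:E)).
  apply: tamed_step_notC => // w; first by move=> [[]].
  by case.
by apply: ge0_subset_integral => // w [].
Qed.

(** * Decay of the weights along a cycle *)

(** With $\theta'$ equal to [p * th], the integral of this over [no_return n] is the quantity $B_n$
    of the proof idea. *)
Definition cycle_weight n (w : W) : R :=
  (expR (p * th * (n.+1 + length_at xi n.+1 w)%:R) * tamed_V (J n.+1 w))%R.

Lemma cycle_weight_transition n w : cycle_weight n w =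
  (expR (p * th * (n + length_at xi n w)%:R) *
   tamed_weight (transition J xi n w))%R.
Proof.
rewrite /cycle_weight /tamed_weight mulrA -expRD length_atS -mulrDr.
by congr (expR (_ * _) * _)%R; rewrite !natrD /= -natr1; ring.
Qed.

Lemma cycle_weight_ge0 n w : (0 <= cycle_weight n w)%R.
Proof. by rewrite mulr_ge0// expR_ge0. Qed.

Lemma measurable_cycle_weight n : measurable_fun setT (cycle_weight n).
Proof.
apply: measurable_funM; last exact: (measurableT_comp measurable_tamed_V).
apply: (@measurableT_comp _ _ _ _ _ _
  (fun k : lattice d => expR (p * th * (n.+1 + norm1 k)%:R))) => //.
exact: measurable_position.
Qed.

(** The weight at [n.+1] is a function of $|S_{n+1}|_1$ times the tamed weight of the next
    transition. On each fiber of $|S_{n+1}|_1$ the first factor is constant and [tamed_step]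
    applies. *)
Lemma cycle_weight_contraction n :
  \int[Pr]_(w in no_return C J chi n.+1) (cycle_weight n.+1 w)%:E <=
  rho%:E * \int[Pr]_(w in no_return C J chi n) (cycle_weight n w)%:E.
Proof.
pose c m := expR (p * th * (n.+1 + m)%:R).
have mA k : measurable (no_return C J chi k).
  by apply: (@past_measurable _ _ _ _ _ J chi xi k); exact: past_no_return.
have mg : measurable_fun setT (fun w => (rho * tamed_V (J n.+1 w))%:E : \bar R).
  apply/measurable_EFinP; apply: measurable_funM => //.
  exact: (measurableT_comp measurable_tamed_V).
have -> : rho%:E * \int[Pr]_(w in no_return C J chi n) (cycle_weight n w)%:E =
    \int[Pr]_(w in no_return C J chi n)
      ((c (length_at xi n.+1 w))%:E * (rho * tamed_V (J n.+1 w))%:E).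
  rewrite -ge0_integralZl_EFin//.
  - by apply: eq_integral => w _; rewrite -!EFinM mulrCA.
  - by move=> w _; rewrite lee_fin cycle_weight_ge0.
  - apply: measurable_funTS; apply/measurable_EFinP.
    exact: measurable_cycle_weight.
under eq_integral do rewrite cycle_weight_transition EFinM.
apply: (@integral_fiber_le _ _ _ Pr (length_at xi n.+1) _ _
  (fun w => (tamed_weight (transition J xi n.+1 w))%:E) _ c) => //.
- exact: measurable_length_at.
- apply/measurable_EFinP; apply: (measurableT_comp measurable_tamed_weight).
  exact: measurable_transition.
- by move=> w; rewrite lee_fin tamed_weight_ge0.
- by move=> w; rewrite lee_fin mulr_ge0.
- by move=> m; exact: expR_ge0.
(* Here [D] is [no_return n] cut by the fiber, an event decided before the coin [chi n.+1]; removing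
   the atom at time [n.+1] turns it into [no_return n.+1] on that fiber. *)
move=> m; rewrite no_returnS setIAC; apply: tamed_step.
  apply: sigma_setI; last exact: past_trans_length_at.
  by apply: past_sub_past_trans; exact: past_no_return.
apply: sigma_setI; last exact: past_length_at.
by apply: (past_mono (leqnSn n)); exact: past_no_return.
Qed.

Hypotheses (start_C : Pr (J 0%N @^-1` C) = 1)
  (start_chi : Pr (chi 0%N @^-1` [set true]) = 1).

Lemma cycle_weight0_fin : \int[Pr]_w (cycle_weight 0 w)%:E < +oo.
Proof.
pose A := J 0%N @^-1` C; pose B := chi 0%N @^-1` [set true].
have pA : past 0 A by exact: past_J.
have pB : past 0 B by exact: past_chi.
have pD : past 0 (A `&` B) by exact: sigma_setI.
have mA : measurable A by exact: past_measurable pA.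
have mB : measurable B by exact: past_measurable pB.
have mD : measurable (A `&` B) by exact: measurableI.
have PrD : Pr (~` (A `&` B)) = 0.
  have PrA : Pr (~` A) = 0 by rewrite probability_setC// start_C subee.
  have PrB : Pr (~` B) = 0 by rewrite probability_setC// start_chi subee.
  by rewrite setCI measureU0//; exact: measurableC.
(* The chain starts in the atom almost surely, so the integral may be restricted to that event,
   where [theta] is at most [eps^-1] times [Q_of]. *)
rewrite (ge0_negligible_integral _ _ _ _ PrD)//; last 3 first.
- exact: measurableC.
- by apply/measurable_EFinP; exact: measurable_cycle_weight.
- by move=> w _; rewrite lee_fin cycle_weight_ge0.
rewrite setTD setCK.
under eq_integral do rewrite cycle_weight_transition /length_at position0
  norm10 addn0 mulr0 expR0 mul1r.
have ieps0 : (0 <= eps^-1)%R by rewrite invr_ge0 ltW.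
(* The absolute value supplies the nonnegative bound that [integral_tamed_weight_le] asks for. *)
apply: (@le_lt_trans _ _ (\int[Pr]_(w in A `&` B)
    (1 - p + (p + delta) * (eps^-1 * cst `|K| w))%:E)).
  apply: (integral_tamed_weight_le pD ieps0) => //.
  - by move=> w E [Cw ->] mE; exact: split_step_le_atom.
  - move=> w [Cw _]; rewrite indicE mem_set// mulr1.
    by rewrite (le_trans (drift_C Cw))// ler_norm.
rewrite /= integral_cst// lte_mul_pinfty ?lee_fin//.
  by rewrite addr_ge0// !mulr_ge0.
by rewrite -ge0_fin_numE// fin_num_measure.
Qed.

End drift.

(** * Functionals of the first cycle *)

(** With $c=1/(1-r)$ one has $1+cr=c$, so a partial sum plus $c\,u_n$ never exceeds $c\,u_0$, by
    induction on [n]. *)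
Lemma nneseries_contraction (R : realType) (u : nat -> \bar R) (r : R) :
  (0 <= r < 1)%R -> (forall n, 0 <= u n) ->
  (forall n, u n.+1 <= r%:E * u n) ->
  \sum_(n <oo) u n <= ((1 - r)^-1)%:E * u 0%N.
Proof.
move=> /andP[r0 r1] u0 ur; set c := ((1 - r)^-1)%R.
have c0 : (0 <= c)%R by rewrite invr_ge0 subr_ge0 ltW.
have cE : (1 + c * r = c)%R.
  by rewrite /c; field; rewrite subr_eq0 gt_eqF.
have partial n : \sum_(0 <= i < n) u i + c%:E * u n <= c%:E * u 0%N.
  elim: n => [|n]; first by rewrite big_nil add0e.
  apply: le_trans; rewrite big_nat_recr//= -addeA leeD2l//.
  rewrite -[in leRHS]cE EFinD ge0_muleDl ?lee_fin ?mulr_ge0// mul1e leeD2l//.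
  by rewrite EFinM -muleA lee_wpmul2l ?lee_fin.
apply: lime_le; first exact: is_cvg_nneseries.
apply: nearW => n; apply: le_trans (partial n).
by rewrite leeDl// mule_ge0 ?lee_fin.
Qed.

(** For $y=sx/(n+1)$, raise $y\le e^y$ to the power [n] and use $ny\le sx$. Dividing by $n+1$
    instead of $n$ covers $n=0$. *)
Lemma exprn_le_expR (R : realType) (s x : R) (n : nat) :
  (0 < s)%R -> (0 <= x)%R ->
  (x ^+ n <= (n.+1%:R / s) ^+ n * expR (s * x))%R.
Proof.
move=> s0 x0; pose y := (s * x / n.+1%:R)%R.
have y0 : (0 <= y)%R by rewrite divr_ge0// mulr_ge0// ltW.
have s_neq0 : s != 0%R by rewrite gt_eqF.
have -> : x = (n.+1%:R / s * y)%R.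
  by rewrite mulrC mulrA divfK ?pnatr_eq0// mulrC mulKf.
rewrite exprMn; set c := (n.+1%:R / s)%R.
have c0 : (0 <= c)%R by rewrite divr_ge0// ltW.
rewrite ler_wpM2l ?exprn_ge0//.
have yE : (y <= expR y)%R by rewrite (le_trans _ (expR_ge1Dx y))// lerDr.
apply: (@le_trans _ _ (expR y ^+ n)%R).
  by rewrite lerXn2r// nnegrE// expR_ge0.
rewrite -expRM_natl ler_expR.
have -> : (s * (c * y) = n.+1%:R * y)%R.
  by rewrite mulrA [(s * c)%R]mulrC divfK.
by rewrite ler_wpM2r// ler_nat.
Qed.

Section cycle.
Context (R : realType) dX (X : measurableType dX) (d : nat).
Context dW (W : measurableType dW).
Variables (C : set X) (J : nat -> {mfun W >-> X}).
Variable chi : nat -> {mfun W >-> bool}.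
Variables (xi : nat -> {mfun W >-> lattice d}) (s : R).
Hypothesis s_gt0 : (0 < s)%R.

Local Notation len := (length_at xi).
Local Notation L1 := (L1 R C J chi).
Local Notation T1 := (T1 R C J chi).
Local Notation Y1 := (Y1 R C J chi xi).
Local Notation no_return := (no_return C J chi).

(** The index is one below the return time: [FirstReturn n] means $T_1=n+1$. Without a return, [L1]
    is infinite but [T1] takes its default 0. *)
Variant first_return_spec (w : W) : \bar R -> nat -> Prop :=
| FirstReturn n of no_return n w : first_return_spec w n.+1%:R%:E n.+1
| NoReturn of (forall n, no_return n w) : first_return_spec w +oo 0.

Lemma first_returnP w : first_return_spec w (L1 w) (T1 w).
Proof.
pose P n := `[< (0 < n)%N /\ in_atom C J chi n w >].
have [exP|noP] := pselect (exists n, P n); last first.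
  have L1E : L1 w = +oo.
    rewrite /Defs.L1 (_ : [set _ | _ in _] = set0) ?ereal_inf0//.
    apply/seteqP; split=> // x [n Pn _]; apply: noP; exists n; exact/asboolP.
  have T1E : T1 w = 0%N.
    by rewrite /Defs.T1; case: xgetP => // n _ /=; rewrite L1E.
  rewrite L1E T1E; apply: NoReturn => n i /andP[i0 _] ai.
  by apply: noP; exists i; apply/asboolP.
case: (ex_minnP exP) => -[|n] /asboolP[]// _ an min_n.
have L1E : L1 w = n.+1%:R%:E.
  apply/eqP; rewrite eq_le; apply/andP; split.
    by apply: ereal_inf_lbound; exists n.+1.
  apply: le_ereal_inf_tmp => _ [m Pm <-]; rewrite lee_fin ler_nat.
  by apply: min_n; apply/asboolP.
have T1E : T1 w = n.+1.
  apply: xget_unique => [|m /=]; first by rewrite /= L1E.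
  by rewrite L1E => -[] /eqP; rewrite eqr_nat => /eqP.
rewrite L1E T1E; apply: FirstReturn => i /andP[i0 lein] ai.
have : (n.+1 <= i)%N by apply: min_n; apply/asboolP.
by rewrite ltnNge lein.
Qed.

(** The terms of the series $\Phi$ of the proof idea, with [s] for $\theta'$; [cycle_bound] is
    $\Phi$. The term of index $T_1-1$ is $\exp\{s(L_1+|Y_1|_1)\}$. *)
Definition cycle_term n : W -> \bar R :=
  (fun w => (expR (s * (n.+1 + len n.+1 w)%:R))%:E) \_ (no_return n).

Definition cycle_bound w : \bar R := \sum_(n <oo) cycle_term n w.

Lemma cycle_term_ge0 n w : 0 <= cycle_term n w.
Proof. by apply: erestrict_ge0 => ? _; rewrite lee_fin expR_ge0. Qed.

Lemma cycle_termE n w : no_return n w ->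
  cycle_term n w = (expR (s * (n.+1 + len n.+1 w)%:R))%:E.
Proof. by move=> nrw; rewrite /cycle_term patchE mem_set. Qed.

Lemma cycle_bound_ge0 w : 0 <= cycle_bound w.
Proof. by apply: nneseries_ge0 => n _ _; exact: cycle_term_ge0. Qed.

(** Every term of the series is then at least 1. *)
Lemma cycle_bound_noreturn w : (forall n, no_return n w) ->
  cycle_bound w = +oo.
Proof.
move=> nrw; apply/eqyP => a a0.
have [n an] : exists n : nat, (a <= n%:R)%R.
  by exists (Num.bound a); rewrite ltW// archi_boundP// ltW.
apply: (@le_trans _ _ (\sum_(0 <= i < n) cycle_term i w)); last first.
  by apply: nneseries_lim_ge => i _ _; exact: cycle_term_ge0.
apply: (@le_trans _ _ (\sum_(0 <= i < n) 1)).
  by rewrite sumEFin lee_fin sumr_const_nat subn0.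
apply: lee_sum => i _; rewrite cycle_termE// lee_fin.
by rewrite -[leLHS]expR0 ler_expR mulr_ge0// ltW.
Qed.

Lemma le_cycle_bound n w : no_return n w ->
  (expR (s * (n.+1 + len n.+1 w)%:R))%:E <= cycle_bound w.
Proof.
move=> nrw; rewrite -cycle_termE//.
apply: (@le_trans _ _ (\sum_(0 <= i < n.+1) cycle_term i w)).
  by rewrite big_nat_recr//= leeDr// sume_ge0// => i _; exact: cycle_term_ge0.
by apply: nneseries_lim_ge => i _ _; exact: cycle_term_ge0.
Qed.

Lemma expeR_cycle_le w :
  expeR (s%:E * (L1 w + (norm1 (Y1 w))%:R%:E)) <= cycle_bound w.
Proof.
rewrite /Defs.Y1; case: first_returnP => [n nrw|nrw]; last first.
  by rewrite cycle_bound_noreturn// leey.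
by rewrite -EFinD -EFinM/= -natrD; exact: le_cycle_bound.
Qed.

(* The value [+oo] of the bound absorbs the paths that never return, where
   [x] may be anything. *)
Lemma expn_cycle_le (a : R) (x : \bar R) p w : (0 < a)%R -> 0 <= x ->
  (forall n, no_return n w -> L1 w = n.+1%:R%:E ->
     x <= (a * (n.+1 + len n.+1 w)%:R)%:E) ->
  x ^+ p <= ((a * (p.+1%:R / s)) ^+ p)%:E * cycle_bound w.
Proof.
move=> a0; have c0 : (0 < (a * (p.+1%:R / s)) ^+ p)%R.
  by rewrite exprn_gt0// mulr_gt0// divr_gt0.
case: first_returnP => [n nrw|nrw] x0 xle; last first.
  by rewrite cycle_bound_noreturn// gt0_muley ?lte_fin// leey.
have {xle} := xle n nrw erefl.
case: x x0 => [y| |]//; rewrite !lee_fin => y0 yle.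
apply: (@le_trans _ _ (((a * (p.+1%:R / s)) ^+ p)%:E *
    (expR (s * (n.+1 + len n.+1 w)%:R))%:E)).
  rewrite -EFin_expe -EFinM lee_fin exprMn -mulrA.
  apply: (@le_trans _ _ ((a * (n.+1 + len n.+1 w)%:R) ^+ p)%R).
    by rewrite lerXn2r// nnegrE// mulr_ge0// ltW.
  by rewrite exprMn ler_wpM2l ?exprn_ge0 ?(ltW a0)// exprn_le_expR.
by rewrite lee_wpmul2l ?lee_fin ?(ltW c0)//; exact: le_cycle_bound.
Qed.

Lemma measurable_no_return n : measurable C -> measurable (no_return n).
Proof.
move=> mC; apply: (@past_measurable _ _ _ _ _ J chi xi n).
exact: past_no_return.
Qed.

Lemma measurable_cycle_term n : measurable C ->
  measurable_fun setT (cycle_term n).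
Proof.
move=> mC; apply/(measurable_restrictT _ (measurable_no_return n mC)).
apply: measurable_funTS; apply/measurable_EFinP.
apply: (@measurableT_comp _ _ _ _ _ _
  (fun k : lattice d => expR (s * (n.+1 + norm1 k)%:R))) => //.
exact: measurable_position.
Qed.

Lemma measurable_cycle_bound : measurable C -> measurable_fun setT cycle_bound.
Proof.
move=> mC; apply: ge0_emeasurable_sum => [n w _ _|n _].
  exact: cycle_term_ge0.
exact: measurable_cycle_term.
Qed.

(** * Rewards with at most linear growth in the increment *)

Section rewards.
Variables (g : X * X * lattice d -> R) (cg : R).
Hypothesis cg_ge0 : (0 <= cg)%R.
Hypothesis g_le :
  forall x y k, (`|g (x, y, k)| <= cg * (1 + (norm1 k)%:R))%R.

Local Notation R1_star := (R1_star C J chi xi g).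

(** $n+|S_n|_1$ is the sum of $1+|X_{i+1}|_1$ over $i<n$, so the growth bound can be summed term by
    term. *)
Lemma sum_reward_le n w : (\sum_(0 <= i < n) `|reward J xi g i w| <=
  cg * (n + len n w)%:R)%R.
Proof.
rewrite length_at_sum -[X in (X + _)%N]card_ord -sum1_card -big_split/=.
rewrite big_mkord natr_sum mulr_sumr; apply: ler_sum => i _.
by rewrite natrD; exact: g_le.
Qed.

Lemma R1_star_ge0 w : 0 <= R1_star w.
Proof. by apply: nneseries_ge0 => n _ _; rewrite lee_fin. Qed.

Lemma R1_star_le n w : L1 w = n.+1%:R%:E ->
  R1_star w <= (cg * (n.+1 + len n.+1 w)%:R)%:E.
Proof.
rewrite /Defs.R1_star => ->; rewrite eseries_mkcond.
rewrite (nneseries_split 0 n.+1); last first.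
  by move=> k _; case: ifP => _; rewrite lee_fin.
rewrite add0n [X in _ + X]eseries0 ?adde0; last first.
  by move=> k nk _; rewrite lte_fin ltr_nat ltnNge nk.
rewrite (le_trans _
  (_ : (\sum_(0 <= i < n.+1) `|reward J xi g i w|)%:E <= _))//.
  rewrite -sumEFin; apply: lee_sum => i _.
  by case: ifP => // _; rewrite lee_fin.
by rewrite lee_fin sum_reward_le.
Qed.

Lemma expeR_R1_star_le w :
  expeR ((s / (cg + 1))%:E * R1_star w) <= cycle_bound w.
Proof.
(* The rate is divided by [cg + 1] rather than [cg], which may be 0; all that matters is
   $c_g/(c_g+1)\le1$. *)
have c0 : (0 < cg + 1)%R by rewrite ltr_wpDl.
have := @R1_star_le ^~ w; case: first_returnP => [n nrw|nrw] R1le; last first.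
  by rewrite cycle_bound_noreturn// leey.
apply: le_trans (le_cycle_bound nrw).
rewrite -[leRHS]/(expeR (s * (n.+1 + len n.+1 w)%:R)%:E) lee_expeR.
apply: (@le_trans _ _ ((s / (cg + 1))%:E * (cg * (n.+1 + len n.+1 w)%:R)%:E)).
  by rewrite lee_wpmul2l ?R1le// lee_fin divr_ge0 ?ltW.
rewrite -EFinM lee_fin -mulrA ler_wpM2l ?(ltW s_gt0)// mulrA ler_piMl//.
by rewrite mulrC ler_pdivrMr// mul1r lerDl.
Qed.

(** Summed over [n], this is a measurable majorant of the absolute reward collected at position [u]
    during the cycle. *)
Definition visit_term (u : lattice d) n : W -> \bar R :=
  (fun w => (cg * (1 + (norm1 (xi n w))%:R) * \1_[set u] (position xi n w))%:E)
    \_ (no_return n).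

Lemma visit_term_ge0 u n w : 0 <= visit_term u n w.
Proof.
by apply: erestrict_ge0 => ? _; rewrite lee_fin !mulr_ge0.
Qed.

Lemma visit_termE u n w : no_return n w -> visit_term u n w =
  (cg * (1 + (norm1 (xi n w))%:R) * \1_[set u] (position xi n w))%:E.
Proof. by move=> nrw; rewrite /visit_term patchE mem_set. Qed.

Definition visit_bound u w : \bar R := \sum_(n <oo) visit_term u n w.

Lemma visit_bound_ge0 u w : 0 <= visit_bound u w.
Proof. by apply: nneseries_ge0 => n _ _; exact: visit_term_ge0. Qed.

Lemma measurable_visit_bound u : measurable C ->
  measurable_fun setT (visit_bound u).
Proof.
move=> mC; apply: ge0_emeasurable_sum => [n w _ _|n _].
  exact: visit_term_ge0.
apply/(measurable_restrictT _ (measurable_no_return n mC)).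
apply: measurable_funTS; apply/measurable_EFinP; apply: measurable_funM.
  exact: (@measurableT_comp _ _ _ _ _ _
    (fun k : lattice d => cg * (1 + (norm1 k)%:R))%R).
apply: (@measurableT_comp _ _ _ _ _ _ (\1_[set u] : lattice d -> R)) => //.
exact: measurable_position.
Qed.

Lemma cycle_visits_le u w :
  `|(\sum_(0 <= n < T1 w) reward J xi g n w * \1_[set u] (position xi n w))%:E|
  <= visit_bound u w.
Proof.
case: first_returnP => [n nrw|nrw]; last first.
  by rewrite big_geq// abse0 visit_bound_ge0.
apply: (@le_trans _ _ (\sum_(0 <= i < n.+1) visit_term u i w)); last first.
  by apply: nneseries_lim_ge => i _ _; exact: visit_term_ge0.
rewrite abse_EFin -[leLHS]/(_%:E).
apply: (@le_trans _ _ (\sum_(0 <= i < n.+1)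
    (`|reward J xi g i w * \1_[set u] (position xi i w)|)%:E)).
  by rewrite sumEFin lee_fin ler_norm_sum.
rewrite big_nat_cond [leRHS]big_nat_cond; apply: lee_sum => i.
rewrite andbT ltnS => /andP[_ lein]; rewrite visit_termE; last first.
  by move=> j /andP[j0 jlei]; apply: nrw; rewrite j0 (leq_trans jlei).
rewrite lee_fin normrM [X in (_ * X <= _)%R]ger0_norm// ler_wpM2r//.
exact: g_le.
Qed.

(** At time [n] the position equals at most one [u] of the duplicate-free list [r], so one summand
    remains. Its linear factor is absorbed by $1+|k|_1\le s^{-1}\exp\{s(1+|k|_1)\}$, and the
    exponents add up to at most that of [cycle_term n]. *)
Lemma sum_visit_term_le (r : seq (lattice d)) n w : uniq r ->
  \sum_(u <- r) (expR (s * (norm1 u)%:R))%:E * visit_term u n w <=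
  (cg / s)%:E * cycle_term n w.
Proof.
move=> uniq_r; have cs0 : (0 <= cg / s)%R by rewrite divr_ge0// ltW.
have [nrw|nrw] := pselect (no_return n w); last first.
  rewrite big1 => [|u _]; last by rewrite /visit_term patchE memNset// mule0.
  by rewrite mule_ge0 ?lee_fin// cycle_term_ge0.
pose S := position xi n w; pose a := (cg * (1 + (norm1 (xi n w))%:R))%R.
have a0 : (0 <= a)%R by rewrite mulr_ge0.
apply: (@le_trans _ _ (expR (s * (norm1 S)%:R) * a)%:E).
  have [Sr|Sr] := boolP (S \in r).
    rewrite (bigD1_seq S)//= big1 ?adde0.
      by rewrite visit_termE// indicE mem_set// mulr1 -EFinM.
    move=> u uS; rewrite visit_termE// indicE memNset ?mulr0 ?mule0//.
    by move=> /= Su; rewrite -Su eqxx in uS.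
  rewrite big_seq big1 => [|u ur]; first by rewrite lee_fin mulr_ge0// expR_ge0.
  rewrite visit_termE// indicE memNset ?mulr0 ?mule0//.
  by move=> /= Su; rewrite -Su in ur; rewrite ur in Sr.
rewrite cycle_termE// -EFinM lee_fin.
have a_le : (a <= cg / s * expR (s * (1 + (norm1 (xi n w))%:R)))%R.
  rewrite /a -mulrA ler_wpM2l// mulrC ler_pdivlMr// mulrC.
  by rewrite (le_trans _ (expR_ge1Dx _))// lerDr.
apply: (le_trans (ler_wpM2l (expR_ge0 _) a_le)).
rewrite mulrCA ler_wpM2l// -expRD ler_expR -mulrDr ler_wpM2l ?(ltW s_gt0)//.
by rewrite length_atS -[(1%R : R)]/(1%:R) -!natrD ler_nat addnCA leq_add2r.
Qed.

Lemma sum_visit_bound_le (r : seq (lattice d)) w : uniq r ->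
  \sum_(u <- r) (expR (s * (norm1 u)%:R))%:E * visit_bound u w <=
  (cg / s)%:E * cycle_bound w.
Proof.
move=> uniq_r; have cs0 : (0 <= cg / s)%R by rewrite divr_ge0// ltW.
rewrite /visit_bound /cycle_bound -nneseriesZl//; last first.
  by move=> n _; exact: cycle_term_ge0.
under eq_bigr => u _.
  rewrite -nneseriesZl; last by move=> n _; exact: visit_term_ge0.
  over.
rewrite -nneseries_sum; last first.
  move=> u n _; apply: mule_ge0; first by rewrite lee_fin expR_ge0.
  exact: visit_term_ge0.
apply: lee_nneseries => n *; last exact: sum_visit_term_le.
apply: sume_ge0 => u _; apply: mule_ge0; first by rewrite lee_fin expR_ge0.
exact: visit_term_ge0.
Qed.

End rewards.

End cycle.

(** * Choice of the constants and conclusion *)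

(** These are the contraction conditions with [rho] equal to [1 - p]. *)
Lemma contraction_parameters (R : realType) (eta eps K : R) :
  (0 < eta < 1)%R -> (0 < eps <= 1)%R -> (0 <= K)%R ->
  exists p delta : R, [/\ (0 < p < 1)%R, (0 <= delta)%R,
    ((p + delta) * eta <= (1 - p) * delta)%R &
    ((1 - p) * (1 - eps) + (p + delta) * K <= 1 - p)%R].
Proof.
move=> /andP[eta0 eta1] /andP[eps0 eps1] K0.
(* With $t=(1-\eta)/2$ and $p=t\delta$, the first condition divided by $\delta$ reads
   $(1+t)(1-2t)\le1-p$, which holds as $p\le t/4$. The second amounts to
   $(p+\delta)K\le(1-p)\varepsilon$; here $\delta K\le\varepsilon/4$, $pK\le\delta K/2$ and
   $p\le1/8$. *)
pose delta := (eps / (4 * (K + 1)))%R; pose p := ((1 - eta) / 2 * delta)%R.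
have D0 : (0 < 4 * (K + 1) :> R)%R by lra.
have deltaE : (delta * (4 * (K + 1)) = eps)%R by rewrite divfK// gt_eqF.
have delta0 : (0 < delta)%R by rewrite divr_gt0.
have t0 : (0 < (1 - eta) / 2 :> R)%R by lra.
have etaE : (eta = 1 - 2 * ((1 - eta) / 2))%R by lra.
have p0 : (0 < p)%R by rewrite mulr_gt0.
have dK0 : (0 <= delta * K)%R by rewrite mulr_ge0// ltW.
have delta1 : (delta <= 4^-1)%R by lra.
have pt : (p <= (1 - eta) / 2 * 4^-1)%R by rewrite ler_wpM2l// ltW.
have p1 : (p <= 8^-1)%R by lra.
have pK : (p * K <= 2^-1 * (delta * K))%R.
  by rewrite -mulrA ler_wpM2r//; lra.
have ep : (eps * p <= eps * 8^-1)%R by rewrite ler_wpM2l// ltW.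
have teta : (((1 - eta) / 2 + 1) * eta <= 1 - p)%R.
  rewrite {2}etaE; set t := ((1 - eta) / 2)%R in t0 pt *; nra.
exists p, delta; split; [lra|exact: ltW| |lra].
have -> : ((p + delta) * eta = ((1 - eta) / 2 + 1) * eta * delta)%R.
  by rewrite /p; ring.
by rewrite ler_wpM2r// ltW.
Qed.

Lemma cycle_bound_integrable (R : realType) (dX : measure_display)
    (X : measurableType dX) (d : nat) (q : lattice d -> R.-ker X ~> X)
    (pi : probability X R) (C : set X) (eps : R)
    (theta : probability (X * lattice d)%type R)
    (V : X -> R) (th b eta : R)
    (dW : measure_display) (W : measurableType dW) (Pr : probability W R)
    (J : nat -> {mfun W >-> X}) (chi : nat -> {mfun W >-> bool})
    (xi : nat -> {mfun W >-> lattice d}) :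
  joint_minorization q pi C eps theta ->
  measurable_fun setT V ->
  (forall x, (1 <= V x)%R) ->
  has_ubound [set V x | x in C] ->
  (0 < th)%R ->
  (0 < eta < 1)%R ->
  exp_drift q C V th b eta ->
  split_chain_from_atom q C eps theta J chi xi pi Pr ->
  exists2 s : R, (0 < s)%R & \int[Pr]_w cycle_bound C J chi xi s w < +oo.
Proof.
move=> [mC piC0 /[dup] eps_itv /andP[eps0 eps1] minor] mV V1 [M VM] th0.
move=> /[dup] eta_itv /andP[/ltW eta0 _] drift [start0 start_chi step coin].
pose K := (eta * `|M| + `|b|)%R.
have K0 : (0 <= K)%R by rewrite addr_ge0// mulr_ge0.
have drift_C x : C x -> (eta * V x + b <= K)%R.
  move=> Cx; rewrite lerD ?ler_norm// ler_wpM2l//.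
  by rewrite (le_trans _ (ler_norm M))//; apply: VM; exists x.
have minor' x E : C x -> measurable E -> eps%:E * theta E <= Q_of q x E.
  exact: minor.
have start_C : Pr (J 0%N @^-1` C) = 1.
  have piC_fin : pi C \is a fin_num by exact: fin_num_measure.
  rewrite start0// setIid -[X in X * _](fineK piC_fin) -EFinM divff//.
  by rewrite fine_eq0// gt_eqF.
have [p [delta [p_itv delta0 h_notC h_C]]] :=
  contraction_parameters eta_itv eps_itv K0.
have /andP[p0 p1] := p_itv.
have p_itv' : (0 <= p <= 1)%R by rewrite !ltW.
(* The rate is $\theta'$. Since [tamed_V] is at least 1, the weights $B_n$, written [u n] below,
   dominate the integrals of the terms of $\Phi$. *)
exists (p * th)%R; first by rewrite mulr_gt0.
pose u n := \int[Pr]_(w in no_return C J chi n)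
  (cycle_weight V th J xi p delta n w)%:E.
have u0_fin : u 0%N < +oo.
  rewrite /u no_return0.
  exact: (cycle_weight0_fin mC eps0 eps1 minor' mV V1 drift drift_C step
    p_itv' delta0 (ltW th0) start_C start_chi).
have u_contraction n : u n.+1 <= (1 - p)%:E * u n.
  exact: (cycle_weight_contraction mC eps0 eps1 minor' mV V1 drift eta0
    drift_C step coin p_itv' delta0 (lexx _) h_notC h_C (ltW th0) n).
have weight_ge n w :
    (expR (p * th * (n.+1 + length_at xi n.+1 w)%:R) <=
     cycle_weight V th J xi p delta n w)%R.
  by rewrite ler_peMr ?expR_ge0// tamed_V_ge1.
have u_ge0 n : 0 <= u n.
  apply: integral_ge0 => w _; rewrite lee_fin.
  exact: le_trans (expR_ge0 _) (weight_ge n w).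
rewrite /cycle_bound integral_nneseries//; last 2 first.
- by move=> n; exact: measurable_cycle_term.
- by move=> n w _; exact: cycle_term_ge0.
apply: (@le_lt_trans _ _ (\sum_(n <oo) u n)).
  apply: lee_nneseries => n *.
    by apply: integral_ge0 => w _; exact: cycle_term_ge0.
  rewrite /cycle_term -integral_mkcond; apply: integral_mono => w _.
    by rewrite lee_fin expR_ge0.
  by rewrite lee_fin.
have r_itv : (0 <= 1 - p < 1)%R by rewrite subr_ge0 ltW//= gtrBl.
apply: (le_lt_trans (nneseries_contraction r_itv u_ge0 u_contraction)).
rewrite lte_mul_pinfty// lee_fin invr_ge0 subr_ge0.
by case/andP: r_itv => _ /ltW.
Qed.

Theorem theorem3p11 (R : realType) (dX : measure_display)
    (X : measurableType dX) (d : nat) (q : lattice d -> R.-ker X ~> X)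
    (pi : probability X R) (C : set X) (eps : R)
    (theta : probability (X * lattice d)%type R)
    (V : X -> R) (th b eta : R)
    (dW : measure_display) (W : measurableType dW) (Pr : probability W R)
    (J : nat -> {mfun W >-> X}) (chi : nat -> {mfun W >-> bool})
    (xi : nat -> {mfun W >-> lattice d}) :
  (0 < d)%N ->
  standard_borel R X ->
  markov_renewal_kernel q ->
  strict_kernel q ->
  positive_harris (P_of q) pi ->
  finite_positive_means q pi ->
  joint_minorization q pi C eps theta ->
  measurable_fun setT V ->
  (forall x, (1 <= V x)%R) ->
  has_ubound [set V x | x in C] ->
  (0 < th)%R ->
  (0 < eta < 1)%R ->
  exp_drift q C V th b eta ->
  split_chain_from_atom q C eps theta J chi xi pi Pr ->
  [/\ exists2 th1 : R, (0 < th1)%R &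
        \int[Pr]_w expeR (th1%:E *
          (L1 R C J chi w + (norm1 (Y1 R C J chi xi w))%:R%:E)) < +oo,
      forall p : nat,
        \int[Pr]_w (L1 R C J chi w ^+ p) < +oo /\
        \int[Pr]_w ((norm1 (Y1 R C J chi xi w))%:R ^+ p)%:E < +oo
    & forall (g : X * X * lattice d -> R) (cg : R),
        measurable_fun setT g ->
        (forall x y k, (`|g (x, y, k)| <= cg * (1 + (norm1 k)%:R))%R) ->
        [/\ exists2 th2 : R, (0 < th2)%R &
              \int[Pr]_w expeR (th2%:E * R1_star C J chi xi g w) < +oo,
            \int[Pr]_w (L1 R C J chi w ^+ 2
              + ((norm1 (Y1 R C J chi xi w))%:R ^+ 2)%:E
              + R1_star C J chi xi g w ^+ 2) < +oo
          & exists2 th3 : R, (0 < th3)%R &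
              \esum_(u in [set: lattice d])
                ((expR (th3 * (norm1 u)%:R))%:E
                  * `|cycle_reward C J chi xi Pr g u|) < +oo]].
Proof.
move=> _ _ _ _ _ _ minor mV V1 VM th0 eta_itv drift split.
have mC : measurable C by case: minor.
have [s s0 Phi_fin] :=
  cycle_bound_integrable minor mV V1 VM th0 eta_itv drift split.
set Phi := cycle_bound C J chi xi s in Phi_fin.
have Phi0 w : 0 <= Phi w by exact: cycle_bound_ge0.
have mPhi : measurable_fun setT Phi by exact: measurable_cycle_bound.
(* All integrability claims except the one on [cycle_reward] reduce to a pointwise bound by a
   multiple of $\Phi$. *)
have dominated (f : W -> \bar R) (c : R) : (0 <= c)%R ->
    (forall w, 0 <= f w) -> (forall w, f w <= c%:E * Phi w) ->
    \int[Pr]_w f w < +oo.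
  move=> c0 f0 fPhi.
  apply: (@le_lt_trans _ _ (\int[Pr]_w (c%:E * Phi w))).
    exact: integral_mono.
  by rewrite ge0_integralZl_EFin// lte_mul_pinfty ?lee_fin.
have L1_ge0 w : 0 <= L1 R C J chi w.
  by case: first_returnP => // n _; rewrite lee_fin.
have L1_le n w : no_return C J chi n w -> L1 R C J chi w = n.+1%:R%:E ->
    L1 R C J chi w <= (1 * (n.+1 + length_at xi n.+1 w)%:R)%:E.
  by move=> _ ->; rewrite mul1r lee_fin ler_nat leq_addr.
have Y1_le n w : no_return C J chi n w -> L1 R C J chi w = n.+1%:R%:E ->
    (norm1 (Y1 R C J chi xi w))%:R%:E <=
    (1 * (n.+1 + length_at xi n.+1 w)%:R)%:E :> \bar R.
  rewrite /Y1; case: first_returnP => // m _ _ [] /eqP.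
  rewrite eqr_nat => /eqP ->.
  by rewrite mul1r lee_fin ler_nat leq_addl.
have c_ge0 (a : R) k : (0 < a)%R -> (0 <= (a * (k.+1%:R / s)) ^+ k)%R.
  by move=> a0; rewrite exprn_ge0// mulr_ge0 ?divr_ge0 ?ltW.
have L1_pow k w : L1 R C J chi w ^+ k <= ((1 * (k.+1%:R / s)) ^+ k)%:E * Phi w.
  by apply: expn_cycle_le => // n nrw L1E; exact: L1_le.
have Y1_pow k w : ((norm1 (Y1 R C J chi xi w))%:R ^+ k)%:E <=
    ((1 * (k.+1%:R / s)) ^+ k)%:E * Phi w.
  by rewrite EFin_expe; apply: expn_cycle_le => // n nrw L1E; exact: Y1_le.
split.
- exists s => //; apply: (dominated _ 1%R) => // w; first exact: expeR_ge0.
  by rewrite mul1e expeR_cycle_le.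
- move=> k; split; apply: (dominated _ _ (c_ge0 1%R k _)) => // w.
  exact: expe_ge0.
move=> g cg0 mg g_le0.
(* The absolute value makes the constant nonnegative and keeps the growth bound. *)
pose cg : R := `|cg0|%R; have cg_ge0 : (0 <= cg)%R by exact: normr_ge0.
have g_le x y k : (`|g (x, y, k)| <= cg * (1 + (norm1 k)%:R))%R.
  by rewrite (le_trans (g_le0 x y k))// ler_wpM2r// ler_norm.
have cg1 : (0 < cg + 1)%R by rewrite ltr_wpDl.
have R1_le n w : no_return C J chi n w -> L1 R C J chi w = n.+1%:R%:E ->
    R1_star C J chi xi g w <=
    ((cg + 1) * (n.+1 + length_at xi n.+1 w)%:R)%:E.
  move=> _ L1E; rewrite (le_trans (R1_star_le xi g_le L1E))// lee_fin.
  by rewrite ler_wpM2r// lerDl.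
split.
- exists (s / (cg + 1))%R; first by rewrite divr_gt0.
  apply: (dominated _ 1%R) => // w; first exact: expeR_ge0.
  by rewrite mul1e expeR_R1_star_le.
(* The three constants of [expn_cycle_le] at exponent 2, whence the 3. *)
- pose c := (((1 * (3%:R / s)) ^+ 2) + ((1 * (3%:R / s)) ^+ 2) +
    (((cg + 1) * (3%:R / s)) ^+ 2))%R.
  apply: (dominated _ c) => [|w|w].
  + by rewrite !addr_ge0// c_ge0.
  + rewrite !adde_ge0// ?expe_ge0 ?R1_star_ge0// lee_fin exprn_ge0//.
  rewrite /c !EFinD !ge0_muleDl ?lee_fin ?addr_ge0// ?c_ge0//.
  rewrite !leeD//; apply: expn_cycle_le => //; first exact: R1_star_ge0.
  by move=> n nrw L1E; exact: R1_le.
exists s => //.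
pose B := 2%:E * \int[Pr]_w ((cg / s)%:E * Phi w).
have cs0 : (0 <= cg / s)%R by rewrite divr_ge0// ltW.
apply: (@le_lt_trans _ _ B); last first.
  rewrite lte_mul_pinfty ?lee_fin//.
  by apply: (dominated _ (cg / s)%R) => // w; rewrite mule_ge0// lee_fin.
(* The sum over the lattice is a supremum over finite sets, so it suffices to bound every finite sum
   by the same [B]. *)
apply: ge_ereal_sup => _ [F [finF _] <-].
rewrite fsbig_finite//; set r := finmap.enum_fset _.
pose f u w := (expR (s * (norm1 u)%:R))%:E * visit_bound C J chi xi cg u w.
have f0 u w : 0 <= f u w.
  by apply: mule_ge0; [rewrite lee_fin expR_ge0|exact: visit_bound_ge0].
have mv u : measurable_fun setT (visit_bound C J chi xi cg u).
  exact: measurable_visit_bound.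
have mf u : measurable_fun setT (f u) by exact: measurable_funeM.
(* Each cycle reward is bounded by twice the integral of its visit majorant. The finite sum then
   moves inside the integral, where the pointwise estimate is uniform in the finite set. *)
apply: (@le_trans _ _ (2%:E * \int[Pr]_w (\sum_(u <- r) f u w))).
  rewrite ge0_integral_sum// ge0_sume_distrr; last first.
    by move=> u _; exact: integral_ge0.
  apply: lee_sum => u _; rewrite ge0_integralZl_EFin ?expR_ge0//; last first.
    by move=> w _; exact: visit_bound_ge0.
  rewrite muleCA lee_wpmul2l ?lee_fin ?expR_ge0//.
  by apply: abse_integral_le => w; exact: cycle_visits_le.
rewrite lee_wpmul2l ?lee_fin//; apply: integral_mono => w _.
  exact: sume_ge0.
by apply: sum_visit_bound_le => //; exact: finmap.fset_uniq.
Qed.
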